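(* Let $a\ge 1$ and $m\ge 1$ be integers. (1) Let $F\in\mathbb{C}[x,y]$ be a nonzero polynomial of bidegree $(a,am)$. Then there is a unique divisor $C\subset\mathbb{F}_m$ which is an $(a,am)$-divisor of $F$. (2) Let $C\subset\mathbb{F}_m$ be an effective divisor with $C\sim aS_+$. Then there exists a polynomial $F$ (unique up to multiplication with a constant) of bidegree $(a,am)$ such that $C$ is its $(a,am)$-divisor. Moreover, if $C$ is irreducible, then so is $F$. Let now $F$ and $C$ be as in (1) or (2) (so $C$ is the $(a,am)$-divisor of $F$), let $G=\sum_{i=0}^a x_0^i\,x_1^{a-i}\,G_{m(a-i)}(y_0,y_1)$ be a polynomial on $\mathbb{F}_m$ whose zero set (as a divisor) is $C$, where each $G_{m(a-i)}$ is homogeneous of degree $m(a-i)$, and let $r$ be an integer with $0\le r<a$. The following are equivalent: (i) $F$ is a polynomial of bidegree $(a,am-r)$; (ii) $y_1^{\,r-\lfloor ir/a\rfloor}$ divides $G_{m(a-i)}$ for all $i=0,\dots,a$. Moreover, with $p=[0:1;1:0]$, for small $r$ the following hold: (A) For $r=1$, (i) holds if and only if the local intersection multiplicity at $p$ of $C$ with the fiber $\{y_1=0\}$ equals $a$, or $\{y_1=0\}$ is a component of $C$. (B) For $r=2$ and $a=3$, (i) holds if and only if (a) $m_p(C)=3$, or (b) $m_p(C)=2$ and $C$ has only one tangent direction at $p$, namely the one given by $y_1=0$.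
   Context: Everything is over $\mathbb{C}$. For $m\ge 0$, the Hirzebruch surface $\mathbb{F}_m$ is the quotient of $(\mathbb{A}^2\setminus\{0\})^2$ by the relation $((x_0,x_1),(y_0,y_1))\sim((\mu x_0,\lambda^{-m}\mu x_1),(\lambda y_0,\lambda y_1))$ for $\lambda,\mu\in\mathbb{C}^*$; classes are written $[x_0:x_1;y_0:y_1]$. It is a $\mathbb{P}^1$-bundle over $\mathbb{P}^1$ via $[x_0:x_1;y_0:y_1]\mapsto[y_0:y_1]$, with fibers $f$. $S_-$ is the section $x_1=0$ (self-intersection $-m$) and $S_+$ the section $x_0=0$ (self-intersection $m$). $\sim$ between divisors denotes linear equivalence, and $m_p(C)$ is the multiplicity of $C$ at $p$. The embedding $\iota_m:\mathbb{A}^2\hookrightarrow\mathbb{F}_m$ is $(x,y)\mapsto[x:1;y:1]$. A polynomial $F\in\mathbb{C}[x,y]$ has bidegree $(a,b)$ if its Newton polygon lies in the triangle with vertices $(a,0),(0,0),(0,b)$, i.e. every monomial $x^iy^j$ occurring in it has $(i,j)$ in that triangle. For $F$ of bidegree $(a,am)$, an $(a,am)$-divisor of $F$ is an effective divisor $C\subset\mathbb{F}_m$ with $C\sim aS_+$ whose restriction to $\iota_m(\mathbb{A}^2)$ corresponds, via $\iota_m$, to the zero set of $F$ in $\mathbb{A}^2$ (as a divisor).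
   Formalization: (B) as stated fails when m_p(C)>3 (e.g. m=2, F=1: (i) holds but m_p(C)=6). What is proved: (B) with (a) read as m_p(C)≥3 for all C, and (B) with m_p(C)=3 literally when m=1 or {y_1=0} is not a component of C. *)

(* Defs.v *)
From HB Require Import structures.
From mathcomp Require Import all_boot all_order all_algebra.
From mathcomp Require Import generic_quotient fraction.
From mathcomp Require Import boolp classical_sets cardinality reals.
From mathcomp Require Import complex.
From mathcomp Require Import mpoly.

Set Implicit Arguments.
Unset Strict Implicit.
Unset Printing Implicit Defensive.

Import GRing.Theory.
Local Open Scope ring_scope.
Local Open Scope quotient_scope.
Local Open Scope classical_set_scope.

Section Polynomials.
Variable K : fieldType.

Definition mdivides n (p q : {mpoly K[n]}) : Prop := exists s, q = s * p.

Definition irreducible_mpoly n (p : {mpoly K[n]}) : Prop :=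
  [/\ p != 0, p \isn't a GRing.unit &
      forall s t, p = s * t -> s \is a GRing.unit \/ t \is a GRing.unit].

Definition in_triangle (a b i j : nat) : Prop :=
  exists s t : rat,
    [/\ 0 <= s, 0 <= t, s + t <= 1, i%:R = s * a%:R & j%:R = t * b%:R].

Definition bidegree (a b : nat) (F : {mpoly K[2]}) : Prop :=
  forall e : 'X_{1..2}, e \in msupp F -> in_triangle a b (e 0) (e 1).

Definition evalA2 (f : {mpoly K[2]}) (q : K * K) : K :=
  f.@[fun i => [:: q.1; q.2]`_i].

(* f(q + (x, y)), the Taylor expansion of f at q. *)
Definition translate (f : {mpoly K[2]}) (q : K * K) : {mpoly K[2]} :=
  f \mPo [tuple 'X_0 + q.1%:MP; 'X_1 + q.2%:MP].

Definition algebraic_set (Y : set (K * K)) : Prop :=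
  exists S : set {mpoly K[2]},
    Y = [set q | forall f, S f -> evalA2 f q = 0].

Definition generates_ideal (pi : {mpoly K[2]}) (Y : set (K * K)) : Prop :=
  forall f, (forall q, Y q -> evalA2 f q = 0) <-> mdivides pi f.

Definition multiplicity_at (f : {mpoly K[2]}) (q : K * K) (n : nat) : Prop :=
  pihomog mdeg n (translate f q) != 0 /\
  forall d, (d < n)%N -> pihomog mdeg d (translate f q) = 0.

Definition local_ring (q : K * K) : set {fraction {mpoly K[2]}} :=
  [set x | exists g h, evalA2 h q != 0 /\ x = tofrac g / tofrac h].

Definition local_ideal (q : K * K) (f g : {mpoly K[2]}) :
    set {fraction {mpoly K[2]}} :=
  [set x | exists s t, [/\ local_ring q s, local_ring q t &
                         x = s * tofrac f + t * tofrac g]].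

(* dim_K O_q/(f,g) = n, by exhibiting a K-basis with n elements. *)
Definition local_dim (q : K * K) (f g : {mpoly K[2]}) (n : nat) : Prop :=
  exists b : 'I_n -> {fraction {mpoly K[2]}},
    (forall i, local_ring q (b i)) /\
    forall x, local_ring q x -> exists! c : {ffun 'I_n -> K},
      local_ideal q f g (x - \sum_i tofrac (c i)%:MP * b i).

End Polynomials.

Section Hirzebruch.
Variables (K : fieldType) (m : nat).

(* ((x0, x1), (y0, y1)) *)
Definition coords := {q : (K * K) * (K * K) | (q.1 != 0) && (q.2 != 0)}.

Definition coords_eqv (q q' : coords) : Prop :=
  exists l u : K, [/\ l != 0, u != 0 &
    val q' = ((u * (val q).1.1, l ^- m * u * (val q).1.2),
              (l * (val q).2.1, l * (val q).2.2))].

Definition coords_rel (q q' : coords) : bool := `[< coords_eqv q q' >].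

Lemma coords_rel_refl : reflexive coords_rel.
Proof.
move=> q; apply/asboolP; exists 1, 1; split; rewrite ?oner_neq0 //.
by rewrite expr1n invr1 !mul1r; case: (val q) => [[? ?] [? ?]].
Qed.

Lemma coords_rel_sym : ssrbool.symmetric coords_rel.
Proof.
suff H q q' : coords_eqv q q' -> coords_eqv q' q.
  by move=> q q'; apply/asboolP/asboolP; exact: H.
move=> [l [u [l0 u0 E]]]; exists l^-1, u^-1; rewrite !invr_eq0; split=> //.
rewrite E /= !mulrA !(mulVf u0) !(mulVf l0) !mul1r exprVn invrK.
rewrite [l ^+ m * _]mulrC -!mulrA [l ^+ m * _]mulrA divff ?expf_neq0 // mul1r.
by rewrite mulrA mulVf // mul1r; case: (val q) => [[? ?] [? ?]].
Qed.

Lemma coords_rel_trans : transitive coords_rel.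
Proof.
move=> q2 q1 q3 /asboolP[l [u [l0 u0 E]]] /asboolP[l' [u' [l0' u0' E']]].
apply/asboolP; exists (l' * l), (u' * u); split; rewrite ?mulf_neq0 //.
by rewrite E' E /= exprMn invfM !mulrA [l' ^- m * u' / _]mulrAC.
Qed.

Canonical coords_equiv :=
  EquivRel coords_rel coords_rel_refl coords_rel_sym coords_rel_trans.

Definition hirzebruch := {eq_quot coords_rel}.

(* The four standard charts A^2 -> F_m: the pair b tells which of the
   coordinates x0, x1 and which of y0, y1 is set to 1.  The chart
   (false, false) is the embedding (x, y) |-> [x : 1; y : 1], and the chart
   (false, true) is (u, v) |-> [u : 1; 1 : v]. *)
Definition affine_coord (A : pzSemiRingType) (b : bool) (u : A) : A * A :=
  if b then (1, u) else (u, 1).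

Lemma chart_subproof (b : bool * bool) (q : K * K) :
  (affine_coord b.1 q.1 != 0) && (affine_coord b.2 q.2 != 0).
Proof.
by apply/andP; split; rewrite /affine_coord; case: ifP => _; rewrite xpair_eqE
  oner_eq0 ?andbF.
Qed.

Definition chart (b : bool * bool) (q : K * K) : hirzebruch :=
  \pi_hirzebruch
    (exist _ (affine_coord b.1 q.1, affine_coord b.2 q.2) (chart_subproof b q)).

Definition affine_chart : bool * bool := (false, false).

(* The variables of {mpoly K[4]} are x0, x1, y0, y1, in this order. *)
Definition evalA4 (H : {mpoly K[4]}) (q : coords) : K :=
  H.@[fun i => [:: (val q).1.1; (val q).1.2; (val q).2.1; (val q).2.2]`_i].

Definition zero_locus (H : {mpoly K[4]}) : set hirzebruch :=
  [set z | exists q, z = \pi_hirzebruch q /\ evalA4 H q = 0].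

Definition Splus : set hirzebruch := zero_locus 'X_0.
Definition fiber_y1 : set hirzebruch := zero_locus 'X_3.

Lemma pt_p_subproof :
  (((0, 1) : K * K) != 0) && (((1, 0) : K * K) != 0).
Proof. by rewrite !xpair_eqE oner_eq0 andbF. Qed.

Definition pt_p : hirzebruch :=
  \pi_hirzebruch (exist _ ((0, 1), (1, 0)) pt_p_subproof).

(* Equivalently, H(mu x0, lambda^-m mu x1, lambda y0, lambda y1) = mu^d lambda^e H. *)
Definition bihomogeneous (d : nat) (e : int) (H : {mpoly K[4]}) : Prop :=
  forall k : 'X_{1..4}, k \in msupp H ->
    (k 0%R + k 1%R)%N = d /\ (k 2%R + k 3%R)%:Z - (m * k 1%R)%:Z = e.

Definition dehomogenize (b : bool * bool) (H : {mpoly K[4]}) : {mpoly K[2]} :=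
  H \mPo [tuple (affine_coord b.1 'X_0).1; (affine_coord b.1 'X_0).2;
                (affine_coord b.2 'X_1).1; (affine_coord b.2 'X_1).2].

(* Zariski topology of F_m, glued from those of the charts. *)
Definition zclosed (Z : set hirzebruch) : Prop :=
  forall b, algebraic_set (chart b @^-1` Z).

Definition zirreducible (Z : set hirzebruch) : Prop :=
  [/\ Z !=set0, zclosed Z &
      forall A B, zclosed A -> zclosed B -> Z `<=` A `|` B ->
        Z `<=` A \/ Z `<=` B].

(* Irreducible closed subsets of codimension one. *)
Definition prime_divisor (Z : set hirzebruch) : Prop :=
  [/\ zirreducible Z, Z <> setT &
      forall W, zirreducible W -> Z `<=` W -> W = Z \/ W = setT].

Definition meets_chart (b : bool * bool) (Z : set hirzebruch) : Prop :=
  chart b @^-1` Z !=set0.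

(* The order of vanishing along Z of a regular function f on the chart b: with
   pi a local equation of Z, it is the n with f in (pi^n) but not in
   (pi^(n+1)). *)
Definition ord_along (b : bool * bool) (Z : set hirzebruch)
    (f : {mpoly K[2]}) (n : int) : Prop :=
  exists (pi : {mpoly K[2]}) (k : nat),
    [/\ generates_ideal pi (chart b @^-1` Z), n = k%:Z,
        mdivides (pi ^+ k) f & ~ mdivides (pi ^+ k.+1) f].

(* A Weil divisor is given by its coefficients; it is constrained by
   [is_divisor] to be a finite integral combination of prime divisors. *)
Definition divisor := set hirzebruch -> int.

Definition is_divisor (D : divisor) : Prop :=
  (forall Z, D Z != 0 -> prime_divisor Z) /\ finite_set [set Z | D Z != 0].

Definition effective (D : divisor) : Prop :=
  is_divisor D /\ forall Z, 0 <= D Z.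

Definition mult_prime (n : int) (Z : set hirzebruch) : divisor :=
  fun W => if `[< W = Z >] then n else 0.

Definition irreducible_divisor (D : divisor) : Prop :=
  exists Z, prime_divisor Z /\ D = mult_prime 1 Z.

(* D - D' is the divisor of a rational function on F_m; the latter is an
   invariant rational function H / H' on the space of coordinates, that is, a
   quotient of two bihomogeneous polynomials of the same degrees. *)
Definition linear_equiv (D D' : divisor) : Prop :=
  exists d e (H H' : {mpoly K[4]}),
    [/\ bihomogeneous d e H, bihomogeneous d e H', H != 0, H' != 0 &
      forall Z, prime_divisor Z -> forall b, meets_chart b Z ->
        exists n n', [/\ ord_along b Z (dehomogenize b H) n,
                         ord_along b Z (dehomogenize b H') n' &
                         D Z - D' Z = n - n']].

(* The restriction of D to the chart b is the divisor of f on A^2; the prime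
   divisors of the chart are the traces of those of F_m meeting it. *)
Definition local_equation (D : divisor) (b : bool * bool) (f : {mpoly K[2]}) :
    Prop :=
  forall Z, prime_divisor Z -> meets_chart b Z -> ord_along b Z f (D Z).

Definition divisor_of_zeros (H : {mpoly K[4]}) (D : divisor) : Prop :=
  forall b, local_equation D b (dehomogenize b H).

Definition polynomial_divisor (a : nat) (F : {mpoly K[2]}) (C : divisor) :
    Prop :=
  [/\ effective C, linear_equiv C (mult_prime a%:Z Splus) &
      local_equation C affine_chart F].

Definition component (Z : set hirzebruch) (D : divisor) : Prop := D Z != 0.

Definition multiplicity (D : divisor) (p : hirzebruch) (n : nat) : Prop :=
  exists b q f,
    [/\ chart b q = p, local_equation D b f & multiplicity_at f q n].

(* w is a tangent vector at the point q of the chart b, which is a zero of the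
   leading form of D at q. *)
Definition tangent_direction (D : divisor) (b : bool * bool) (q w : K * K) :
    Prop :=
  exists f n, [/\ local_equation D b f, multiplicity_at f q n, w != 0 &
                  evalA2 (pihomog mdeg n (translate f q)) w = 0].

Definition same_tangent_directions (D E : divisor) (p : hirzebruch) : Prop :=
  forall b q, chart b q = p ->
    forall w, tangent_direction D b q w <-> tangent_direction E b q w.

Definition intersection_multiplicity (D E : divisor) (p : hirzebruch)
    (n : nat) : Prop :=
  exists b q f g, [/\ chart b q = p, local_equation D b f,
                      local_equation E b g & local_dim q f g n].

Definition form_of (a : nat) (g : 'I_a.+1 -> {mpoly K[2]}) : {mpoly K[4]} :=
  \sum_(i < a.+1) 'X_0 ^+ i * 'X_1 ^+ (a - i) * (g i \mPo [tuple 'X_2; 'X_3]).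

End Hirzebruch.

Arguments mult_prime {K m}.
Arguments Splus {K m}.
Arguments fiber_y1 {K m}.
Arguments pt_p {K m}.

(* Main.v *)
(** In each of the four charts, isomorphic to the affine plane, the prime divisors
    are the zero sets of the irreducible polynomials: K[x, y] is factorial, and a
    polynomial vanishing on the zero set of an irreducible p is a multiple of p.
    Both facts come from a Bezout identity [u p + v q = r(y) <> 0] when p involves
    x and does not divide q.  The order of a bihomogeneous form along a prime
    divisor then does not depend on the chart in which it is computed.

    If an effective C is linearly equivalent to a S_+ through H / H', then
    x0^a H / H' is a polynomial in every chart; comparing the chart [x:1;y:1] with
    [1:x;y:1] bounds its degree in x by a, and comparing it with [x:1;1:y] bounds
    each monomial x^i y^j by m i + j <= m a.  So C is the divisor of a form of
    bidegree (a, 0), which is determined by C up to a constant.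

    At p, in the chart [x:1;1:y], a monomial x^i y^j of F becomes
    x^i y^(m (a - i) - j), and bidegree (a, a m - r) means that each monomial
    x^i y^l of the local equation satisfies (a - i) r <= a l.  Conditions (ii), (A)
    and (B) are read off this inequality; in (A), the local ring at p modulo
    (f, y) has dimension the order of vanishing of f(x, 0) at 0. *)

Require Import Defs.
From HB Require Import structures.
From mathcomp Require Import all_boot all_order all_algebra.
From mathcomp Require Import generic_quotient fraction.
From mathcomp Require Import boolp classical_sets cardinality reals.
From mathcomp Require Import complex.
From mathcomp Require Import mpoly.
From mathcomp Require Import zify ring.

Set Implicit Arguments.
Unset Strict Implicit.
Unset Printing Implicit Defensive.

Import GRing.Theory.
Local Open Scope ring_scope.

(** * Factorization in K[x, y] *)

(** An (a, am)-divisor is prescribed on one chart only. The complement of that chart consists of S_-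
    and the fiber y_1 = 0, whose multiplicities are invisible there; linear equivalence with a S_+
    pins them down.

    The obstacle in comparing charts is that a restriction does not show the bidegree of the form it
    comes from: two forms with equal restrictions to one chart agree elsewhere only up to powers of
    the coordinates set to 1 in that chart. These powers are harmless for orders along a divisor
    meeting both charts, but they carry the degree bounds. Hence F is first homogenized in an
    artificially large bidegree, and only the powers left over in the other charts reveal that (a,
    0) suffices.

    Since the units of K[x, y] are the constants, a local equation in a single chart is determined
    up to a constant. Both uniqueness claims rest on this, as does the freedom to compute
    multiplicities and tangents at p with one chosen equation. *)

Definition irreducible_elt (A : idomainType) (p : A) : Prop :=
  [/\ p != 0, p \isn't a GRing.unit &
      forall s t, p = s * t -> s \is a GRing.unit \/ t \is a GRing.unit].

Section PolyPoly.
Variable K : closedFieldType.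
Implicit Types (p q s t h g : {poly {poly K}}) (c d e : {poly K}).

(** In [{poly {poly K}}] the outer variable plays the role of x and the inner one that of y. This
    specializes y and leaves a polynomial in x. *)
Definition eval_inner (y : K) : {poly {poly K}} -> {poly K} :=
  map_poly (horner_eval y).

HB.instance Definition _ y := GRing.RMorphism.on (eval_inner y).

Lemma horner_eval_inner y p x : (eval_inner y p).[x] = p.[x%:P].[y].
Proof.
by rewrite -{1}[x](hornerC x y) -[x%:P.[y]]/(horner_eval y x%:P) horner_map.
Qed.

Lemma eval_innerC y c : eval_inner y c%:P = c.[y]%:P.
Proof. by rewrite /eval_inner map_polyC. Qed.

Lemma eval_innerM y p q : eval_inner y (p * q) = eval_inner y p * eval_inner y q.
Proof. exact: rmorphM. Qed.

Lemma eval_inner_eq0 y p :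
  eval_inner y p = 0 -> exists q, p = q * ('X - y%:P)%:P.
Proof.
move=> /polyP E; exists (map_poly (fun c => c %/ ('X - y%:P)) p).
apply/polyP => i; rewrite coefMC coef_map_id0 ?div0p //.
rewrite divpK // dvdp_XsubCl; move: (E i).
by rewrite coef_map coef0 /= /horner_eval => /eqP.
Qed.

Lemma root_of_nonunit c : c != 0 -> c \isn't a GRing.unit ->
  exists y d, c = d * ('X - y%:P).
Proof.
move=> c0 cU; case: (closed_rootP c _) => [|y].
  apply: contra cU => /eqP c1; rewrite poly_unitE c1 eqxx unitfE.
  by move: c0; rewrite -lead_coef_eq0 lead_coefE c1.
by move=> /factor_theorem[d ->]; exists y, d.
Qed.

Lemma poly_poly_neq0_eval p : p != 0 -> exists x y, p.[x%:P].[y] != 0.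
Proof.
rewrite -lead_coef_eq0 => /closed_nonrootP[y py].
have /closed_nonrootP[x px] : eval_inner y p != 0.
  apply: contraNneq py => /polyP/(_ (size p).-1).
  by rewrite coef_map coef0 /= -lead_coefE => /rootP.
by exists x, y; rewrite -horner_eval_inner.
Qed.

(* Gauss's lemma: if [r] is a root of [c], then [h * g] vanishes modulo
   [y - r], hence so does [h] or [g]. *)
Lemma factor_out_constant c p h g : c != 0 -> c%:P * p = h * g ->
  exists d e h' g',
    [/\ d != 0, e != 0, h = d%:P * h', g = e%:P * g' & p = h' * g'].
Proof.
elim/ltn_ind: {c}(size c) {-2}c (erefl (size c)) p h g => n IH c cn p h g c0 E.
have [cU|cU] := boolP (c \is a GRing.unit).
  exists c, 1, (c^-1%:P * h), g; rewrite !mul1r oner_neq0; split=> //.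
    by rewrite mulrA -polyCM divrr // mul1r.
  by rewrite -mulrA -E mulrA -polyCM mulVr // mul1r.
have [y [c' cE]] := root_of_nonunit c0 cU.
have c'0 : c' != 0 by apply: contraNneq c0 => c'0; rewrite cE c'0 mul0r.
have lt_c' : (size c' < n)%N.
  by rewrite -cn cE size_Mmonic ?monicXsubC // size_XsubC addn2.
have X0 : ('X - y%:P)%:P != 0 :> {poly {poly K}}.
  by rewrite polyC_eq0 polyXsubC_eq0.
have /eqP : eval_inner y h * eval_inner y g = 0.
  rewrite -eval_innerM -E eval_innerM eval_innerC cE hornerM hornerXsubC.
  by rewrite subrr mulr0 mul0r.
rewrite mulf_eq0 => /orP[] /eqP/eval_inner_eq0[f fE].
  have E' : c'%:P * p = f * g.
    apply: (mulfI X0); rewrite mulrA -polyCM [_ * c']mulrC -cE E fE.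
    by rewrite [f * _]mulrC !mulrA.
  have [d [e [h' [g' [d0 e0 fE' gE pE]]]]] := IH _ lt_c' _ erefl _ _ _ c'0 E'.
  exists (('X - y%:P) * d), e, h', g'; split=> //.
    by rewrite mulf_neq0 ?polyXsubC_eq0.
  by rewrite fE fE' mulrC polyCM mulrA.
have E' : c'%:P * p = h * f.
  apply: (mulfI X0); rewrite mulrA -polyCM [_ * c']mulrC -cE E fE.
  by rewrite mulrA mulrC.
have [d [e [h' [g' [d0 e0 hE fE' pE]]]]] := IH _ lt_c' _ erefl _ _ _ c'0 E'.
exists d, (('X - y%:P) * e), h', g'; split=> //.
  by rewrite mulf_neq0 ?polyXsubC_eq0.
by rewrite fE fE' mulrC polyCM mulrA.
Qed.

Lemma size_poly_unit p : p \is a GRing.unit -> size p = 1%N.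
Proof. by rewrite poly_unitE => /andP[/eqP]. Qed.

(** This descends from divisibility over K(y) to K[y]: Gauss's lemma distributes c over t and p, and
    the share taken by p is a unit because p is irreducible and involves x. *)
Lemma irreducible_cancel_constant p c q t :
  irreducible_elt p -> (1 < size p)%N -> c != 0 ->
  c%:P * q = t * p -> exists t', q = t' * p.
Proof.
move=> [p0 pU irr] p1 c0 /(factor_out_constant c0).
move=> [d [e [t' [p' [d0 e0 _ pE ->]]]]].
case: (irr _ _ pE) => [eU|/size_poly_unit p'1]; last first.
  by move: p1; rewrite pE mul_polyC size_scale // p'1.
exists (t' * e%:P^-1); rewrite -mulrA; congr (_ * _).
by rewrite pE mulrA mulVr ?mul1r.
Qed.

(** Over K[y] a gcd is known only up to factors from K[y]. If it involves x, then by Gauss's lemma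
    it is p up to such a factor, which can be cancelled; otherwise Bezout gives r. *)
Lemma irreducible_dichotomy p q : irreducible_elt p -> (1 < size p)%N ->
  (exists t, q = t * p) \/
  exists u v r, r != 0 /\ u * p + v * q = r%:P.
Proof.
move=> pirr p1; have [p0 pU irr] := pirr.
have [/Bezout_coprimepP[[u v] /= uv]|g1] := boolP (coprimep p q); [right|left].
  have r1 : size (u * p + v * q) = 1%N by rewrite (eqp_size uv) size_poly1.
  exists u, v, (u * p + v * q)`_0; rewrite -size1_polyC ?r1 //; split=> //.
  by rewrite -[_`_0]/(_`_(1.-1)) -r1 -lead_coefE lead_coef_eq0 -size_poly_eq0 r1.
rewrite coprimep_def in g1.
have /Pdiv.Idomain.dvdpP[[c h] /= c0] := dvdp_gcdl p q.
rewrite -mul_polyC => /(factor_out_constant c0).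
move=> [d [e [h' [g' [d0 e0 _ gE pE]]]]].
have g'1 : size g' != 1%N by rewrite -(size_scale g' e0) -mul_polyC -gE.
have {}g'1 : g' \isn't a GRing.unit by apply: contra g'1 => /size_poly_unit ->.
case: (irr _ _ pE) => [h'U|]; last by rewrite (negPf g'1).
have /Pdiv.Idomain.dvdpP[[c2 t] /= c20] := dvdp_gcdr p q.
rewrite -mul_polyC => E2.
apply: (@irreducible_cancel_constant p c2 q (t * e%:P * h'^-1)) => //.
by rewrite E2 gE pE -!mulrA mulKr.
Qed.

Lemma irreducible_polyC p : irreducible_elt p -> (size p <= 1)%N ->
  exists y k, k \is a GRing.unit /\ p = k * ('X - y%:P)%:P.
Proof.
move=> [p0 pU irr] /size1_polyC pE; set c := p`_0 in pE.
have c0 : c != 0 by rewrite -polyC_eq0 -pE.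
have cU : c \isn't a GRing.unit.
  apply: contra pU; rewrite pE => cU; rewrite poly_unitE size_polyC c0 coefC.
  by rewrite cU.
have [y [d cE]] := root_of_nonunit c0 cU.
have pE' : p = d%:P * ('X - y%:P)%:P by rewrite pE cE polyCM.
exists y, d%:P; split; last exact: pE'.
case: (irr _ _ pE') => [//|].
by rewrite poly_unitE coefC /= poly_unitE size_XsubC andbF.
Qed.

Lemma irreducible_poly_prime p s t : irreducible_elt p ->
  (exists w, s * t = w * p) -> (exists w, s = w * p) \/ (exists w, t = w * p).
Proof.
move=> pirr [w wE]; have [/(irreducible_polyC pirr)|p1] := leqP (size p) 1.
  move=> [y [k [kU pE]]].
  have div r : eval_inner y r = 0 -> exists w, r = w * p.
    move=> /eval_inner_eq0[v ->]; exists (v * k^-1).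
    by rewrite pE -mulrA mulKr.
  have /eqP : eval_inner y s * eval_inner y t = 0.
    rewrite -eval_innerM wE pE !eval_innerM eval_innerC hornerXsubC subrr !mulr0 //.
  by rewrite mulf_eq0 => /orP[] /eqP/div; [left|right].
case: (irreducible_dichotomy s pirr p1) => [|[u [v [r [r0 E]]]]]; [by left|].
(* The Bezout identity multiplied by t exhibits r t as a multiple of p. *)
right; apply: (@irreducible_cancel_constant p r t (u * t + v * w)) => //.
by rewrite -E !mulrDl -!mulrA wE [p * t]mulrC.
Qed.

Lemma irreducible_poly_nullstellensatz p q : irreducible_elt p ->
  (forall x y, p.[x%:P].[y] = 0 -> q.[x%:P].[y] = 0) -> exists t, q = t * p.
Proof.
move=> pirr V; have [/(irreducible_polyC pirr)|p1] := leqP (size p) 1.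
  move=> [y [k [kU pE]]].
  have /eval_inner_eq0[v ->] : eval_inner y q = 0.
    apply/eqP/negPn/negP => /closed_nonrootP[x] /rootP; apply.
    by rewrite horner_eval_inner V // pE !hornerE subrr mulr0.
  by exists (v * k^-1); rewrite pE -mulrA mulKr.
case: (irreducible_dichotomy q pirr p1) => [//|[u [v [r [r0 E]]]]].
have p0 : p != 0 by case: pirr.
(* Where the leading coefficient of p does not vanish, p(x, y) keeps its positive degree in x and so
   has a root. Both p and q vanish there, yet r(y) does not. *)
have /closed_nonrootP[y] : r * lead_coef p != 0 by rewrite mulf_neq0 ?lead_coef_eq0.
rewrite rootM negb_or => /andP[ry py].
have /closed_rootP[x] : size (eval_inner y p) != 1%N.
  by rewrite size_map_poly_id0 ?neq_ltn ?p1 ?orbT.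
rewrite rootE horner_eval_inner => /eqP pxy.
case/negP: ry; rewrite rootE -[r](hornerC r x%:P) -E !hornerE V //= pxy.
by rewrite !mulr0 addr0.
Qed.

End PolyPoly.

(** * Units, divisibility and irreducible factors of multivariate polynomials *)

Section Monomials.
Variables (K : fieldType) (n : nat).
Implicit Types (f g : {mpoly K[n]}).

Lemma mpoly_unitE f : (f \is a GRing.unit) = (msize f == 1%N).
Proof.
apply/idP/msize_poly1P => [/unitrP[g [_ fg]]|[c c0 ->]]; last first.
  by apply/unitrP; exists c^-1%:MP; rewrite -!mpolyCM mulVf ?divff.
have f0 : f != 0 by apply: contra_eq_neq fg => ->; rewrite mul0r eq_sym oner_neq0.
have g0 : g != 0 by apply: contra_eq_neq fg => ->; rewrite mulr0 eq_sym oner_neq0.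
apply/msize_poly1P; have := msizeM f0 g0; rewrite fg msize1.
have arith (a b : nat) : a != 0%N -> b != 0%N -> 1%N = (a + b).-1 -> a == 1%N.
  by lia.
by apply: arith; rewrite msize_poly_eq0.
Qed.

Lemma msize_lt_mul_nonunit f g : f != 0 -> g != 0 -> g \isn't a GRing.unit ->
  (msize f < msize (f * g))%N.
Proof.
move=> f0 g0; rewrite mpoly_unitE msizeM //.
have arith (x y : nat) : x != 0%N -> y != 0%N -> y != 1%N -> (x < (x + y).-1)%N.
  by lia.
by apply: arith; rewrite msize_poly_eq0.
Qed.

Lemma mdivides_refl f : mdivides f f.
Proof. by exists 1; rewrite mul1r. Qed.

Lemma mdivides_trans f g h : mdivides f g -> mdivides g h -> mdivides f h.
Proof. by move=> [s ->] [t ->]; exists (t * s); rewrite mulrA. Qed.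

Lemma mdivides_mulr f g h : mdivides f g -> mdivides f (g * h).
Proof. by move=> [s ->]; exists (s * h); rewrite mulrAC. Qed.

Lemma mdivides_mull f g h : mdivides f h -> mdivides f (g * h).
Proof. by rewrite mulrC; exact: mdivides_mulr. Qed.

Lemma mdivides_mul f g h k :
  mdivides f g -> mdivides h k -> mdivides (f * h) (g * k).
Proof. by move=> [s ->] [t ->]; exists (s * t); rewrite mulrACA. Qed.

Lemma mdivides_exp_le f i j : (i <= j)%N -> mdivides (f ^+ i) (f ^+ j).
Proof. by move=> ij; exists (f ^+ (j - i)); rewrite -exprD subnK. Qed.

Lemma mdivides_cancel f g h : h != 0 -> mdivides (h * f) (h * g) -> mdivides f g.
Proof. by move=> h0 [s E]; exists s; apply: (mulfI h0); rewrite E mulrCA. Qed.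

Lemma mdivides_anti f g : f != 0 -> mdivides f g -> mdivides g f ->
  exists2 c, c != 0 & g = c *: f.
Proof.
move=> f0 [s gE] [t fE]; have st : t * s = 1.
  by apply: (mulIf f0); rewrite mul1r -mulrA -gE -fE.
have /msize_poly1P[c c0 sE] : msize s == 1%N.
  by rewrite -mpoly_unitE; apply/unitrP; exists t; split; rewrite // mulrC.
by exists c => //; rewrite gE sE mul_mpolyC.
Qed.

Lemma mdividesZr f g c : c != 0 -> mdivides f (c *: g) <-> mdivides f g.
Proof.
move=> c0; split=> [[s E]|]; last by rewrite -mul_mpolyC; exact: mdivides_mull.
exists (c^-1 *: s); rewrite -scalerAl -E scalerA mulVf ?scale1r //.
Qed.

Lemma irreducible_factor f : f != 0 -> f \isn't a GRing.unit ->
  exists2 p, irreducible_mpoly p & mdivides p f.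
Proof.
elim/ltn_ind: {f}(msize f) {-2}f (erefl (msize f)) => k IH f fk f0 fU.
case: (pselect (irreducible_mpoly f)) => [firr|nirr].
  by exists f => //; exact: mdivides_refl.
have [s [t [fE sU tU]]] : exists s t,
    [/\ f = s * t, s \isn't a GRing.unit & t \isn't a GRing.unit].
  apply: contrapT => H; apply: nirr; split=> // s t fE.
  have [sU|sU] := boolP (s \is a GRing.unit); [by left | right].
  by apply/negPn/negP => tU; apply: H; exists s, t.
have /andP[s0 t0] : (s != 0) && (t != 0) by rewrite -negb_or -mulf_eq0 -fE.
have [|p pirr ps] := IH (msize s) _ s erefl s0 sU; last first.
  by exists p => //; apply: mdivides_trans ps _; rewrite fE mulrC; exists t.
by rewrite -fk fE; exact: msize_lt_mul_nonunit.
Qed.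

Lemma mdivides_XnP (i : 'I_n) k f :
  mdivides ('X_i ^+ k) f <-> forall e, e \in msupp f -> (k <= e i)%N.
Proof.
rewrite mpolyXn; split=> [[s ->] e|H].
  rewrite (perm_mem (msuppMX _ _)) => /mapP[e' _ ->].
  by rewrite mnmDE mulmnE mnm1E eqxx mul1n leq_addr.
exists (\sum_(e <- msupp f) f@_e *: 'X_[e - U_(i) *+ k]).
rewrite {1}[f]mpolyE mulr_suml; apply: eq_big_seq => e ef.
rewrite -scalerAl -mpolyXD submK //.
apply/mnm_lepP => j; rewrite mulmnE mnm1E; case: eqP => [<-|]; last by rewrite mul0n.
by rewrite mul1n H.
Qed.

End Monomials.

(** * Transfer of factoriality and the Nullstellensatz to K[x, y] *)

Section Bivariate.
Variable K : closedFieldType.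
Implicit Types (f g p q : {mpoly K[2]}).

(** The isomorphism of K[x, y] with K[y][x], where pseudo-division in x is available. *)
Definition to_poly_poly f : {poly {poly K}} :=
  mmap (polyC \o polyC) (fun i : 'I_2 => if i == 0 then 'X else 'X%:P) f.

Lemma to_poly_polyD f g :
  to_poly_poly (f + g) = to_poly_poly f + to_poly_poly g.
Proof. exact: mmapD. Qed.

Lemma to_poly_poly1 : to_poly_poly 1 = 1.
Proof. exact: rmorph1. Qed.

Lemma to_poly_polyM f g :
  to_poly_poly (f * g) = to_poly_poly f * to_poly_poly g.
Proof. exact: rmorphM. Qed.

Lemma eq_mnm2 (e e' : 'X_{1..2}) : (e == e') = (e 0 == e' 0) && (e 1 == e' 1).
Proof.
apply/eqP/andP => [->//|[/eqP e0 /eqP e1]].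
apply/mnmP; case=> [[|[|//]] i].
  by rewrite [Ordinal i](_ : _ = 0) //; apply: val_inj.
by rewrite [Ordinal i](_ : _ = 1) //; apply: val_inj.
Qed.

Lemma to_poly_poly_coef f (e : 'X_{1..2}) : (to_poly_poly f)`_(e 0)`_(e 1) = f@_e.
Proof.
rewrite /to_poly_poly /mmap !coef_sum [RHS](congr1 (mcoeff e) (mpolyE f)).
rewrite raddf_sum; apply: eq_bigr => k _ /=.
rewrite mcoeffZ mcoeffX /mmap1 big_ord_recl big_ord1 /= -polyC_exp.
rewrite coefCM coefMC coefXn [lift _ _](_ : _ = 1); last exact: val_inj.
rewrite coefCM; congr (_ * _); rewrite eq_mnm2 eq_sym andbC.
by case: eqP => _; rewrite ?andbF ?andbT ?mul0r ?coef0 // mul1r coefXn eq_sym.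
Qed.

Lemma to_poly_poly_inj : injective to_poly_poly.
Proof. by move=> f g E; apply/mpolyP => e; rewrite -!to_poly_poly_coef E. Qed.

Lemma to_poly_polyC c : to_poly_poly c%:MP = c%:P%:P.
Proof. exact: mmapC. Qed.

Lemma to_poly_polyX0 : to_poly_poly 'X_0 = 'X.
Proof. by rewrite /to_poly_poly mmapX mmap1U. Qed.

Lemma to_poly_polyX1 : to_poly_poly 'X_1 = 'X%:P.
Proof. by rewrite /to_poly_poly mmapX mmap1U. Qed.

Lemma to_poly_poly_surj h : exists f, to_poly_poly f = h.
Proof.
have surjC c : exists f, to_poly_poly f = c%:P.
  elim/poly_ind: c => [|c k [f fE]].
    by exists 0%:MP; rewrite to_poly_polyC.
  exists (f * 'X_1 + k%:MP).
  by rewrite to_poly_polyD to_poly_polyM fE to_poly_polyX1 to_poly_polyC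
    polyCD polyCM.
elim/poly_ind: h => [|h c [f fE]]; first by exists 0%:MP; rewrite to_poly_polyC.
have [g gE] := surjC c; exists (f * 'X_0 + g).
by rewrite to_poly_polyD to_poly_polyM fE to_poly_polyX0 gE.
Qed.

Lemma to_poly_poly_eval f x y : (to_poly_poly f).[x%:P].[y] = evalA2 f (x, y).
Proof.
rewrite /to_poly_poly /mmap !horner_sum /evalA2 mevalE; apply: eq_bigr => k _.
rewrite /mmap1 !big_ord_recl !big_ord0 /= !mulr1.
rewrite [lift _ _](_ : _ = 1); last exact: val_inj.
by rewrite !(hornerE, horner_exp).
Qed.

Lemma to_poly_poly_divides f g :
  mdivides f g <-> exists t, to_poly_poly g = t * to_poly_poly f.
Proof.
split=> [[s ->]|[t]]; first by exists (to_poly_poly s); rewrite to_poly_polyM.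
have [s <-] := to_poly_poly_surj t.
by rewrite -to_poly_polyM => /to_poly_poly_inj ->; exists s.
Qed.

Lemma to_poly_poly_unit f :
  (to_poly_poly f \is a GRing.unit) = (f \is a GRing.unit).
Proof.
apply/unitrP/unitrP => [[h []]|[g [gf fg]]].
  have [g <-] := to_poly_poly_surj h; rewrite -!to_poly_polyM -to_poly_poly1.
  by move=> /to_poly_poly_inj gf /to_poly_poly_inj fg; exists g.
by exists (to_poly_poly g); rewrite -!to_poly_polyM gf fg to_poly_poly1.
Qed.

Lemma to_poly_poly_irreducible p :
  irreducible_mpoly p -> irreducible_elt (to_poly_poly p).
Proof.
move=> [p0 pU irr]; split; rewrite ?to_poly_poly_unit //.
  by rewrite -(inj_eq to_poly_poly_inj) [to_poly_poly 0](to_poly_polyC 0) in p0.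
move=> s t; have [f <-] := to_poly_poly_surj s; have [g <-] := to_poly_poly_surj t.
by rewrite -to_poly_polyM !to_poly_poly_unit => /to_poly_poly_inj /irr.
Qed.

Lemma irreducible_prime p f g : irreducible_mpoly p ->
  mdivides p (f * g) -> mdivides p f \/ mdivides p g.
Proof.
move=> /to_poly_poly_irreducible pirr; rewrite !to_poly_poly_divides.
by rewrite to_poly_polyM; apply: irreducible_poly_prime.
Qed.

Lemma irreducible_nullstellensatz p f : irreducible_mpoly p ->
  (forall q : K * K, evalA2 p q = 0 -> evalA2 f q = 0) -> mdivides p f.
Proof.
move=> /to_poly_poly_irreducible pirr V; rewrite to_poly_poly_divides.
apply: irreducible_poly_nullstellensatz => // x y; rewrite !to_poly_poly_eval.
exact: V.
Qed.

Lemma mpoly_neq0_eval f : f != 0 -> exists q : K * K, evalA2 f q != 0.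
Proof.
move=> f0; have [|x [y]] := @poly_poly_neq0_eval K (to_poly_poly f).
  by rewrite -(inj_eq to_poly_poly_inj) [to_poly_poly 0](to_poly_polyC 0) in f0.
by rewrite to_poly_poly_eval; exists (x, y).
Qed.

Lemma irreducible_has_zero p : irreducible_mpoly p ->
  exists q : K * K, evalA2 p q = 0.
Proof.
move=> pirr; apply: contrapT => H; have [_ + _] := pirr; apply/negP/negPn.
have [|s E] := @irreducible_nullstellensatz p 1 pirr.
  by move=> q pq; case: H; exists q.
by apply/unitrP; exists s; split; last rewrite mulrC; rewrite -E.
Qed.

Lemma mdivides_exp_cancel p f g k : irreducible_mpoly p -> ~ mdivides p f ->
  mdivides (p ^+ k) (f * g) -> mdivides (p ^+ k) g.
Proof.
move=> pirr pf; have [p0 _ _] := pirr.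
elim: k g => [|k IH] g; first by exists g; rewrite expr0 mulr1.
rewrite exprS => H; have [//|[h hE]] : mdivides p f \/ mdivides p g.
  apply: irreducible_prime => //; apply: mdivides_trans H.
  by rewrite mulrC; exists (p ^+ k).
rewrite hE mulrC; apply: mdivides_mul (IH _ _) (mdivides_refl _).
apply: (mdivides_cancel p0); move: H; congr mdivides.
by rewrite hE mulrA mulrC.
Qed.

(** The induction splits one prime p off both f and g. The hypothesis passes to the quotients: for a
    prime q dividing p it is used with exponent k + 1, and for any other q the factor p is
    cancelled. *)
Lemma divides_of_prime_powers f g : f != 0 ->
  (forall p k, irreducible_mpoly p -> mdivides (p ^+ k) f -> mdivides (p ^+ k) g) ->
  mdivides f g.
Proof.
elim/ltn_ind: {f}(msize f) {-2}f (erefl (msize f)) g => n IH f fn g f0 H.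
have [fU|fU] := boolP (f \is a GRing.unit).
  by exists (g / f); rewrite divrK.
have [p pirr [f1 fE]] := irreducible_factor f0 fU.
have [p0 pU _] := pirr.
have [g1 gE] : mdivides p g.
  by apply: (H p 1%N pirr); rewrite expr1; exists f1.
have f10 : f1 != 0 by apply: contraNneq f0 => f10; rewrite fE f10 mul0r.
rewrite fE gE; apply: mdivides_mul (mdivides_refl _); apply: (IH _ _ _ erefl) => //.
  by rewrite -fn fE; exact: msize_lt_mul_nonunit.
move=> q k qirr qf1; case: (pselect (mdivides q p)) => [[s sE]|qp].
  have [q0 qU qirr'] := qirr; have [_ _ pirr'] := pirr.
  have sU : s \is a GRing.unit by case: (pirr' _ _ sE) => //; rewrite (negPf qU).
  have : mdivides (q ^+ k.+1) g.
    apply: H => //; rewrite fE exprS mulrC sE.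
    by apply: mdivides_mul => //; exists s.
  rewrite gE exprS sE mulrA [g1 * s * q]mulrC => /(mdivides_cancel q0) [t tE].
  by exists (t / s); rewrite mulrAC -tE mulrK.
apply: (mdivides_exp_cancel qirr qp); rewrite mulrC -gE; apply: H => //.
by rewrite fE; apply: mdivides_mulr.
Qed.
End Bivariate.

(** * Charts and homogenization *)

Section Charts.
Variables (K : fieldType) (m : nat).
Local Open Scope quotient_scope.
Implicit Types (f : {mpoly K[2]}) (H : {mpoly K[4]}) (b : bool * bool).
Implicit Types (c : (K * K) * (K * K)) (q : K * K).

Definition eval4 H c : K := H.@[fun i => [:: c.1.1; c.1.2; c.2.1; c.2.2]`_i].

Definition affine_point b q : (K * K) * (K * K) :=
  (affine_coord b.1 q.1, affine_coord b.2 q.2).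

Lemma evalA2M f g q : evalA2 (f * g) q = evalA2 f q * evalA2 g q.
Proof. exact: mevalM. Qed.

Lemma evalA2X f n q : evalA2 (f ^+ n) q = evalA2 f q ^+ n.
Proof. exact: (rmorphXn (meval _)). Qed.

Lemma evalA2XU q : (evalA2 'X_0 q = q.1) * (evalA2 'X_1 q = q.2).
Proof. by rewrite /evalA2 !mevalXU. Qed.

Lemma eval4M H H' c : eval4 (H * H') c = eval4 H c * eval4 H' c.
Proof. exact: mevalM. Qed.

Lemma eval4X H n c : eval4 (H ^+ n) c = eval4 H c ^+ n.
Proof. exact: (rmorphXn (meval _)). Qed.

Lemma eval_dehomogenize b H q :
  evalA2 (dehomogenize b H) q = eval4 H (affine_point b q).
Proof.
rewrite /evalA2 comp_mpoly_meval; apply: meval_eq => i.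
rewrite (tnth_nth 0) /affine_coord.
by case: b i => [[] []] [[|[|[|[|//]]]] Hi] /=; rewrite ?mevalXU ?meval1.
Qed.

Lemma dehomogenizeM b H H' :
  dehomogenize b (H * H') = dehomogenize b H * dehomogenize b H'.
Proof. exact: rmorphM. Qed.

Lemma dehomogenizeX b H n : dehomogenize b (H ^+ n) = dehomogenize b H ^+ n.
Proof. exact: rmorphXn. Qed.

Lemma bihomogeneous_eval d e H l u c : bihomogeneous m d e H ->
  l != 0 -> u != 0 ->
  eval4 H ((u * c.1.1, l ^- m * u * c.1.2), (l * c.2.1, l * c.2.2)) =
  u ^+ d * l ^ e * eval4 H c.
Proof.
move=> Hde l0 u0; rewrite /eval4 !mevalE mulr_sumr; apply: eq_big_seq => k /Hde.
move=> [<- <-]; rewrite mulrCA; congr (_ * _).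
rewrite !big_ord_recl !big_ord0 /= !mulr1.
rewrite [lift _ _](_ : _ = 1%R); last exact: val_inj.
rewrite [lift _ _](_ : _ = 2%R); last exact: val_inj.
rewrite [lift _ _](_ : _ = 3%R); last exact: val_inj.
rewrite expfzDr // -exprnN !exprMn exprVn -exprM -exprnP !exprD.
ring.
Qed.

Lemma bihomogeneousM d e d' e' H H' : bihomogeneous m d e H ->
  bihomogeneous m d' e' H' -> bihomogeneous m (d + d') (e + e') (H * H').
Proof.
move=> Hd Hd' k /msuppM_le/allpairsP[[k1 k2] /= [/Hd[<- <-] /Hd'[<- <-] ->]].
by rewrite !mnmDE; split; lia.
Qed.

Lemma bihomogeneous1 : bihomogeneous m 0 0 (1 : {mpoly K[4]}).
Proof. by move=> k; rewrite msupp1 inE => /eqP ->; rewrite !mnm0E; split; lia. Qed.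

Lemma bihomogeneousX d e H n : bihomogeneous m d e H ->
  bihomogeneous m (n * d) (n%:Z * e) (H ^+ n).
Proof.
move=> Hd; elim: n => [|n IH]; first by rewrite mul0r; exact: bihomogeneous1.
by rewrite exprS mulSn intS mulrDl mul1r; exact: bihomogeneousM.
Qed.

Lemma bihomogeneousXU :
  [/\ bihomogeneous m 1 0 ('X_0 : {mpoly K[4]}),
      bihomogeneous m 1 (- m%:Z) ('X_1 : {mpoly K[4]}),
      bihomogeneous m 0 1 ('X_2 : {mpoly K[4]}) &
      bihomogeneous m 0 1 ('X_3 : {mpoly K[4]})].
Proof.
by split=> k; rewrite msuppX inE => /eqP ->; rewrite !mnm1E /=; split; lia.
Qed.

(* The homogeneous coordinates set to 1 in the chart [b]. *)
Definition unit_coordx b : {mpoly K[4]} := if b.1 then 'X_0 else 'X_1.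
Definition unit_coordy b : {mpoly K[4]} := if b.2 then 'X_2 else 'X_3.

Lemma dehomogenizeXU b :
  [/\ dehomogenize (K := K) b 'X_0 = (if b.1 then 1 else 'X_0),
      dehomogenize (K := K) b 'X_1 = (if b.1 then 'X_0 else 1),
      dehomogenize (K := K) b 'X_2 = (if b.2 then 1 else 'X_1) &
      dehomogenize (K := K) b 'X_3 = (if b.2 then 'X_1 else 1)].
Proof.
by case: b => [[] []]; rewrite /dehomogenize !comp_mpolyXU.
Qed.

(* A form of bidegree [(d, e)] is [unit_coordx ^ d * unit_coordy ^ weight]
   times the pullback of its restriction to the chart [b]. *)
Definition weight b (d : nat) (e : int) : int :=
  e + (if b.1 then 0 else (m * d)%:Z).

(** Rescaling a point so that the two unit coordinates become 1 brings it into the chart; the last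
    clause is the factor by which a form of bidegree (d, e) changes, and explains [weight]. *)
Lemma chart_coordinates b c : eval4 (unit_coordx b) c != 0 ->
    eval4 (unit_coordy b) c != 0 ->
  exists q l u, [/\ l != 0, u != 0,
    affine_point b q = ((u * c.1.1, l ^- m * u * c.1.2), (l * c.2.1, l * c.2.2)) &
    forall d e, u ^+ d * l ^ e =
      eval4 (unit_coordx b) c ^- d * eval4 (unit_coordy b) c ^ (- weight b d e)].
Proof.
(* The action multiplies x1 by l^-m u, so when x1 is the coordinate to normalize, u must also
   contain l^m = y^-m. *)
set x := eval4 _ c; set y := eval4 _ c => x0 y0.
pose l := y^-1; pose u := (if b.1 then 1 else y ^- m) / x.
have l0 : l != 0 by rewrite invr_eq0.
have u0 : u != 0.
  rewrite mulf_neq0 ?invr_eq0 //.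
  by case: ifP; rewrite ?oner_neq0 ?invr_eq0 ?expf_neq0.
exists (if b.1 then l ^- m * u * c.1.2 else u * c.1.1,
        if b.2 then l * c.2.2 else l * c.2.1), l, u; split=> //.
  rewrite /affine_point /affine_coord /u /l; move: x0 y0; rewrite /x /y.
  rewrite /unit_coordx /unit_coordy; case: {x y l u l0 u0} b => b1 b2 /=.
  case: c => [[c1 c2] [c3 c4]]; rewrite /eval4.
  case: b1 b2 => [] [] /=; rewrite !mevalXU /= => x0 y0; congr ((_, _), (_, _));
    by rewrite ?[_^-1 ^+ m]exprVn ?invrK //; field; rewrite ?x0 ?y0 ?expf_neq0.
move=> d e; rewrite /u /l /weight.
rewrite exprz_inv; case: b.1; first by rewrite div1r exprVn addr0.
rewrite exprMn !exprVn -exprM opprD expfzDr // -exprnN; ring.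
Qed.

Lemma unit_coordE b' b : (dehomogenize b' (unit_coordx b) =
    (if b.1 == b'.1 then 1 else 'X_0)) *
  (dehomogenize b' (unit_coordy b) = (if b.2 == b'.2 then 1 else 'X_1)).
Proof.
have [E0 E1 E2 E3] := dehomogenizeXU b'; rewrite /unit_coordx /unit_coordy.
case: b b' E0 E1 E2 E3 => [[] []] [[] []] /= E0 E1 E2 E3; split;
  by rewrite ?E0 ?E1 ?E2 ?E3.
Qed.

End Charts.

Lemma prod_ord2 (A : pzSemiRingType) (F : 'I_2 -> A) :
  \prod_i F i = F 0 * F 1.
Proof.
by rewrite big_ord_recl big_ord1; congr (_ * F _); apply: val_inj.
Qed.

Lemma prod_ord4 (A : pzSemiRingType) (F : 'I_4 -> A) :
  \prod_i F i = F 0 * F 1 * F 2%R * F 3%R.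
Proof.
rewrite !big_ord_recl big_ord0 mulr1 !mulrA.
by congr (_ * F _ * F _ * F _); apply: val_inj.
Qed.

(** * Comparison of restrictions to different charts, and homogenization *)

Section Transfer.
Variables (K : closedFieldType) (m : nat).
Implicit Types (f g w : {mpoly K[2]}) (H : {mpoly K[4]}) (b : bool * bool).

(** The complement of a plane curve is dense: w (f - g) vanishes everywhere. *)
Lemma mpoly_eq_off_zeros f g w : w != 0 ->
  (forall q : K * K, evalA2 w q != 0 -> evalA2 f q = evalA2 g q) -> f = g.
Proof.
move=> w0 E; apply/eqP; rewrite -subr_eq0; apply/negPn/negP => fg.
have [q] : exists q : K * K, evalA2 (w * (f - g)) q != 0.
  by apply: mpoly_neq0_eval; rewrite mulf_neq0.
rewrite evalA2M mulf_eq0 negb_or => /andP[/E fgq].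
by rewrite /evalA2 mevalB -![meval _ _]/(evalA2 _ _) fgq subrr eqxx.
Qed.

Lemma dehomogenize_unit_coordx_neq0 b b' :
  dehomogenize b' (unit_coordx K b) != 0.
Proof.
rewrite unit_coordE; case: ifP => _; first exact: oner_neq0.
by rewrite -msize_poly_eq0 msizeX.
Qed.

Lemma dehomogenize_unit_coord_neq0 b b' :
  dehomogenize b' (unit_coordx K b * unit_coordy K b) != 0.
Proof.
rewrite dehomogenizeM mulf_neq0 ?dehomogenize_unit_coordx_neq0 //.
rewrite unit_coordE; case: ifP => _; first exact: oner_neq0.
by rewrite -msize_poly_eq0 msizeX.
Qed.

(* The powers make the degrees of the two sides equal. *)
Lemma dehomogenize_transfer b b' d1 e1 d2 e2 (n1 n2 : nat) H1 H2 :
  bihomogeneous m d1 e1 H1 -> bihomogeneous m d2 e2 H2 ->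
  dehomogenize b H1 = dehomogenize b H2 ->
  n1%:Z - n2%:Z = weight m b d1 e1 - weight m b d2 e2 ->
  dehomogenize b' (unit_coordx K b ^+ d2 * unit_coordy K b ^+ n2 * H1) =
  dehomogenize b' (unit_coordx K b ^+ d1 * unit_coordy K b ^+ n1 * H2).
Proof.
move=> Hd1 Hd2 E12 n12.
(* It suffices to compare values at points that also lie in the chart b, where rescaling reduces to
   the equality assumed on b. *)
apply: (mpoly_eq_off_zeros (dehomogenize_unit_coord_neq0 b b')) => q.
rewrite !eval_dehomogenize !eval4M !eval4X mulf_eq0 negb_or => /andP[x0 y0].
have [q' [l [u [l0 u0 qE luE]]]] := chart_coordinates m x0 y0.
move: (congr1 (fun f => evalA2 f q') E12); rewrite !eval_dehomogenize qE.
rewrite (bihomogeneous_eval _ Hd1) // (bihomogeneous_eval _ Hd2) // !luE.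
set x := eval4 _ _ in x0 *; set y := eval4 (unit_coordy _ _) _ in y0 *.
set h1 := eval4 _ _; set h2 := eval4 _ _ => E.
have n1E : y ^+ n1 = y ^+ n2 * y ^ weight m b d1 e1 / y ^ weight m b d2 e2.
  rewrite invr_expz !exprnP -!expfzDr //; congr (_ ^ _).
  by rewrite -(addrA n2%:Z) -n12 addrC subrK.
rewrite -!invr_expz in E; move: n1E (expfz_neq0 (weight m b d1 e1) y0) E.
set z1 := y ^ _; set z2 := y ^ _ => n1E z10 E.
have -> : h1 = x ^+ d1 * z1 * (x ^- d1 / z1 * h1).
  by field; rewrite z10 expf_neq0.
by rewrite E n1E; field; rewrite expf_neq0 // expfz_neq0.
Qed.

Lemma dehomogenizeZ b c H : dehomogenize b (c *: H) = c *: dehomogenize b H.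
Proof. exact: comp_mpolyZ. Qed.

Lemma dehomogenize_sum b (I : Type) (r : seq I) (H : I -> {mpoly K[4]}) :
  dehomogenize b (\sum_(i <- r) H i) = \sum_(i <- r) dehomogenize b (H i).
Proof. exact: raddf_sum. Qed.

Lemma dehomogenize0 b : dehomogenize b (0 : {mpoly K[4]}) = 0.
Proof. exact: rmorph0. Qed.

Lemma dehomogenize_eq0 b b' d e H : bihomogeneous m d e H ->
  dehomogenize b H = 0 -> dehomogenize b' H = 0.
Proof.
move=> Hd H0; have H0d : bihomogeneous m d e (0 : {mpoly K[4]}).
  by move=> k; rewrite msupp0.
have := @dehomogenize_transfer b b' d e d e 0 0 _ _ Hd H0d.
rewrite !expr0 !mulr1 mulr0 H0 dehomogenize0.
rewrite !subrr => /(_ erefl erefl)/eqP.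
rewrite dehomogenizeM dehomogenize0 mulf_eq0 => /orP[|/eqP //].
rewrite dehomogenizeX expf_eq0 => /andP[_ E].
by have := dehomogenize_unit_coordx_neq0 b b'; rewrite E.
Qed.

(* The monomial of bidegree [(d, e)] whose restriction to the chart [b] is
   [k], provided that no subtraction is truncated; see [fits]. *)
Definition homogenize_monomial b (d e : nat) (k : 'X_{1..2}) : 'X_{1..4} :=
  let k1 := (if b.1 then k 0%R else d - k 0%R)%N in
  let n := (e + m * k1)%N in
  [multinom [tuple (if b.1 then d - k 0%R else k 0%R)%N; k1;
                   (if b.2 then n - k 1%R else k 1%R)%N;
                   (if b.2 then k 1%R else n - k 1%R)%N]].

Lemma homogenize_monomialE b d e (k : 'X_{1..2})
    (k1 := (if b.1 then k 0%R else d - k 0%R)%N)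
    (n := (e + m * k1)%N) :
  (homogenize_monomial b d e k 0 = (if b.1 then d - k 0%R else k 0%R)%N) *
  (homogenize_monomial b d e k 1 = k1) *
  (homogenize_monomial b d e k 2 = (if b.2 then n - k 1%R else k 1%R)%N) *
  (homogenize_monomial b d e k 3 = (if b.2 then k 1%R else n - k 1%R)%N).
Proof. by do !split; rewrite multinomE (tnth_nth 0%N). Qed.

Lemma mnm2E (i j : nat) :
  ([multinom [tuple i; j]] 0 = i) * ([multinom [tuple i; j]] 1 = j).
Proof. by do !split; rewrite multinomE (tnth_nth 0%N). Qed.

Definition homogenize b (d e : nat) f : {mpoly K[4]} :=
  \sum_(k <- msupp f) f@_k *: 'X_[homogenize_monomial b d e k].

Definition fits b (d e : nat) f : Prop := forall k, k \in msupp f ->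
  (k 0%R <= d)%N /\ (k 1%R <= e + m * (if b.1 then k 0%R else d - k 0%R))%N.

Lemma bihomogeneous_homogenize b d e f :
  fits b d e f -> bihomogeneous m d e (homogenize b d e f).
Proof.
move=> fit k /msupp_sum_le/flatten_mapP[k' ]; rewrite mem_filter /= => kf.
move=> /msuppZ_le; rewrite msuppX inE => /eqP -> /=; have [] := fit _ kf.
rewrite !homogenize_monomialE.
by case: b.1 b.2 => [] []; split; lia.
Qed.

Lemma dehomogenize_monomial b (k : 'X_{1..4}) : dehomogenize b 'X_[K, k] =
  'X_[[multinom [tuple k (if b.1 then 1 else 0); k (if b.2 then 3 else 2)]]].
Proof.
rewrite /dehomogenize comp_mpolyX prod_ord4 !(tnth_nth 0).
rewrite [RHS]mpolyXE_id prod_ord2 !mnm2E.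
by case: b => [[] []] /=; rewrite !expr1n !mulr1 ?mul1r ?mulrA.
Qed.

Lemma dehomogenize_homogenize b b' d e f : dehomogenize b' (homogenize b d e f) =
  \sum_(k <- msupp f) f@_k *: 'X_[[multinom
    [tuple homogenize_monomial b d e k (if b'.1 then 1 else 0);
           homogenize_monomial b d e k (if b'.2 then 3 else 2)]]].
Proof.
rewrite dehomogenize_sum; apply: eq_bigr => k _.
by rewrite dehomogenizeZ dehomogenize_monomial.
Qed.

Lemma homogenizeK b d e f : dehomogenize b (homogenize b d e f) = f.
Proof.
rewrite dehomogenize_homogenize [RHS]mpolyE; apply: eq_bigr => k _.
congr (_ *: 'X_[_]); apply/eqP; rewrite eq_mnm2 !mnm2E.
by case: b => [[] []]; rewrite !homogenize_monomialE !eqxx.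
Qed.

Lemma mnm_le_msize f k (i : 'I_2) : k \in msupp f -> (k i <= msize f)%N.
Proof.
move=> /msize_mdeg_lt; rewrite mdegE (bigD1 i) //=; lia.
Qed.

(** Every exponent of f is at most [msize f], so with this bidegree no subtraction is truncated. It
    is usually too large, and the form may vanish along the complement of the chart. *)
Lemma exists_homogenization b f : exists d (e : int) H,
  bihomogeneous m d e H /\ dehomogenize b H = f.
Proof.
exists (msize f), (msize f)%:Z, (homogenize b (msize f) (msize f) f).
split; last exact: homogenizeK.
apply: bihomogeneous_homogenize => k kf; split; first exact: mnm_le_msize.
by apply: leq_trans (mnm_le_msize _ kf) _; rewrite leq_addr.
Qed.

End Transfer.

(** * Zariski topology and prime divisors *)

Local Open Scope classical_set_scope.

Section Topology.
Variables (K : closedFieldType) (m : nat).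
Local Open Scope quotient_scope.
Local Notation hirz := (hirzebruch K m).
Implicit Types (f g p : {mpoly K[2]}) (H : {mpoly K[4]}) (b : bool * bool).
Implicit Types (Z A B W : set hirz) (q : K * K).

Lemma pi_hirzebruchP (c c' : coords K) :
  \pi_hirz c = \pi_hirz c' <-> coords_eqv m c c'.
Proof.
split=> [/eqmodP/asboolP //|E]; apply/eqmodP; exact/asboolP.
Qed.

Definition bihomog H : Prop := exists d e, bihomogeneous m d e H.

Lemma bihomogM H H' : bihomog H -> bihomog H' -> bihomog (H * H').
Proof.
move=> [d [e Hd]] [d' [e' Hd']]; exists (d + d')%N, (e + e').
exact: bihomogeneousM.
Qed.

Lemma zero_locusE H c : bihomog H ->
  zero_locus H (\pi_hirz c) <-> evalA4 H c = 0.
Proof.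
move=> [d [e Hd]]; split=> [[c' [/esym/pi_hirzebruchP[l [u [l0 u0 E]]] c'0]]|c0].
  have := bihomogeneous_eval (val c') Hd l0 u0; rewrite -E.
  by rewrite -[eval4 _ _]/(evalA4 H c) -[eval4 H (val c')]/(evalA4 H c') c'0 mulr0.
by exists c.
Qed.

Lemma zero_locus_chart H b q : bihomog H ->
  zero_locus H (chart m b q) <-> evalA2 (dehomogenize b H) q = 0.
Proof. by move=> Hd; rewrite eval_dehomogenize; exact: zero_locusE. Qed.

Definition chart_complement b : set hirz :=
  zero_locus (unit_coordx K b * unit_coordy K b).

Lemma bihomog_unit_coord b : bihomog (unit_coordx K b * unit_coordy K b).
Proof.
have [E0 E1 E2 E3] := bihomogeneousXU K m.
rewrite /unit_coordx /unit_coordy; apply: bihomogM; case: ifP => _;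
  by do 2!eexists; eassumption.
Qed.

Lemma in_chart b (z : hirz) : ~ chart_complement b z <-> exists q, z = chart m b q.
Proof.
split=> [|[q ->]]; last first.
  rewrite /chart_complement zero_locus_chart; last exact: bihomog_unit_coord.
  rewrite dehomogenizeM !unit_coordE !eqxx mulr1 => /eqP.
  by rewrite /evalA2 meval1 oner_eq0.
rewrite -[z]reprK; set c := repr z.
rewrite /chart_complement zero_locusE; last exact: bihomog_unit_coord.
rewrite -[evalA4 _ _]/(eval4 _ (val c)) eval4M => /eqP.
rewrite mulf_eq0 negb_or => /andP[x0 y0].
have [q [l [u [l0 u0 qE _]]]] := chart_coordinates m x0 y0.
by exists q; apply/pi_hirzebruchP; exists l, u; split.
Qed.

Lemma exists_chart (z : hirz) : exists b q, z = chart m b q.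
Proof.
rewrite -[z]reprK; case: (repr z) => -[[x0 x1] [y0 y1]] c0.
have /andP[/= x y] := c0.
suff [b bc] : exists b, eval4 (unit_coordx K b * unit_coordy K b)
    ((x0, x1), (y0, y1)) != 0.
  exists b; apply/in_chart; rewrite /chart_complement.
  rewrite zero_locusE; last exact: bihomog_unit_coord.
  exact/eqP.
exists (x0 != 0, y0 != 0); rewrite eval4M mulf_neq0 //.
  rewrite /unit_coordx /eval4; move: x; rewrite xpair_eqE.
  by case: (x0 =P 0) => [->|/eqP x0E] /=; rewrite mevalXU.
rewrite /unit_coordy /eval4; move: y; rewrite xpair_eqE.
by case: (y0 =P 0) => [->|/eqP y0E] /=; rewrite mevalXU.
Qed.

Lemma algebraic_set_zeros f : algebraic_set [set q | evalA2 f q = 0].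
Proof.
by exists [set f]; apply/seteqP; split=> q /=; [move=> fq _ -> | apply].
Qed.

Lemma zclosed_zero_locus H : bihomog H -> zclosed (zero_locus H : set hirz).
Proof.
move=> Hd b; rewrite [X in algebraic_set X](_ : _ =
  [set q | evalA2 (dehomogenize b H) q = 0]).
  exact: algebraic_set_zeros.
by apply/seteqP; split=> q /= /zero_locus_chart; apply.
Qed.

Lemma zclosed_setU A B : zclosed A -> zclosed B -> zclosed (A `|` B).
Proof.
move=> Ac Bc b; have [S SE] := Ac b; have [T TE] := Bc b.
exists [set h | exists f g, [/\ S f, T g & h = f * g]].
rewrite preimage_setU SE TE; apply/seteqP; split=> q /=.
  move=> [Sq|Tq] _ [f [g [Sf Tg ->]]]; rewrite evalA2M.
    by rewrite (Sq _ Sf) mul0r.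
  by rewrite (Tq _ Tg) mulr0.
move=> STq; apply: contrapT => /not_orP[/existsNP[f /not_implyP[Sf /eqP fq]]].
move=> /existsNP[g /not_implyP[Tg /eqP gq]].
have : evalA2 (f * g) q = 0 by apply: STq; exists f, g.
by rewrite evalA2M => /eqP; rewrite mulf_eq0 (negPf fq) (negPf gq).
Qed.

Definition zclosure A : set hirz :=
  [set z | forall Z, zclosed Z -> A `<=` Z -> Z z].

(** An intersection of algebraic sets is cut out by the union of their equations. *)
Lemma zclosed_zclosure A : zclosed (zclosure A).
Proof.
move=> b; exists [set f | exists Z, [/\ zclosed Z, A `<=` Z &
  forall q, Z (chart m b q) -> evalA2 f q = 0]].
apply/seteqP; split=> q /= H.
  by move=> f [Z [Zc AZ]]; apply; exact: H.
move=> Z Zc AZ; have [S SE] := Zc b.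
rewrite -[Z _]/((chart m b @^-1` Z) q) SE => f Sf; apply: H; exists Z; split=> //.
by move=> q'; rewrite -[Z _]/((chart m b @^-1` Z) q') SE; apply.
Qed.

Lemma sub_zclosure A : A `<=` zclosure A.
Proof. by move=> z Az Z _; apply. Qed.

Lemma zclosure_sub A Z : zclosed Z -> A `<=` Z -> zclosure A `<=` Z.
Proof. by move=> Zc AZ z; apply. Qed.

(** Each chart is dense: an equation of Z in another chart vanishes wherever the unit coordinates of
    b do not, hence is zero. *)
Lemma zclosed_dense Z b : zclosed Z -> (forall q, Z (chart m b q)) -> Z = setT.
Proof.
move=> Zc Zb; apply/seteqP; split=> // z _; have [b' [q ->]] := exists_chart z.
have [S SE] := Zc b'.
rewrite -[Z _]/((chart m b' @^-1` Z) q) SE => f Sf.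
suff -> : f = 0 by rewrite /evalA2 meval0.
apply: (mpoly_eq_off_zeros (dehomogenize_unit_coord_neq0 K b b')) => q' /eqP q'b.
rewrite [RHS]meval0.
suff : (chart m b' @^-1` Z) q' by rewrite SE; apply.
have /in_chart[q'' /= ->] : ~ chart_complement b (chart m b' q').
  by rewrite /chart_complement zero_locus_chart //; exact: bihomog_unit_coord.
exact: Zb.
Qed.

(** A covering needs to be tested on one chart only: Z lies in the union of A, B and the complement
    of the chart, and not in the last. *)
Lemma zirreducible_sub Z A B b : zirreducible Z -> meets_chart b Z ->
  zclosed A -> zclosed B ->
  (forall q, Z (chart m b q) -> A (chart m b q) \/ B (chart m b q)) ->
  Z `<=` A \/ Z `<=` B.
Proof.
move=> [_ Zc irr] [q0 Zq0] Ac Bc ZAB.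
have Cc := zclosed_zero_locus (bihomog_unit_coord b).
case: (irr _ _ (zclosed_setU Ac Bc) Cc) => [z Zz|ZAB'|ZC].
- have [zb|/in_chart[q qE]] := pselect (chart_complement b z); [by right|left].
  by rewrite qE; apply: ZAB; rewrite -qE.
- exact: irr.
- have : ~ chart_complement b (chart m b q0) by apply/in_chart; exists q0.
  by move=> /(_ (ZC _ Zq0)).
Qed.

(** The closure is used instead of the zero locus of a homogenization, which may contain extra
    components outside the chart. *)
Definition curve b p : set hirz :=
  zclosure (chart m b @` [set q | evalA2 p q = 0]).

Lemma zclosed_curve b p : zclosed (curve b p).
Proof. exact: zclosed_zclosure. Qed.

(** The closure adds no point in the chart, because a homogenization of p defines a closed set with
    exactly this trace. *)
Lemma curve_chart b p q : curve b p (chart m b q) <-> evalA2 p q = 0.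
Proof.
split=> [|pq]; last by apply: sub_zclosure; exists q.
have [d [e [H [Hd HE]]]] := exists_homogenization m b p.
have Hh : bihomog H by exists d, e.
move=> /(_ _ (zclosed_zero_locus Hh)); rewrite zero_locus_chart // HE.
by apply=> _ [q' pq' <-]; rewrite zero_locus_chart // HE.
Qed.

Lemma curve_sub b p Z : zclosed Z ->
  (forall q, evalA2 p q = 0 -> Z (chart m b q)) -> curve b p `<=` Z.
Proof. by move=> Zc pZ; apply: zclosure_sub => // _ [q pq <-]; exact: pZ. Qed.

Lemma meets_chart_curve b p : irreducible_mpoly p -> meets_chart b (curve b p).
Proof.
by move=> /irreducible_has_zero[q pq]; exists q; apply/curve_chart.
Qed.

Lemma curve_neqT b p : irreducible_mpoly p -> curve b p <> setT.
Proof.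
move=> [p0 _ _] E; have [q] := mpoly_neq0_eval p0; apply/negP/negPn/eqP.
by have /curve_chart : curve b p (chart m b q) by rewrite E.
Qed.

(** A closed set not containing the curve has an equation on the chart that p does not divide. The
    product of two such equations would vanish on the curve, so p would divide it. *)
Lemma zirreducible_curve b p : irreducible_mpoly p -> zirreducible (curve b p).
Proof.
move=> pirr; have [q0 pq0] := irreducible_has_zero pirr.
split; [by exists (chart m b q0); apply/curve_chart|exact: zclosed_curve|].
move=> A B Ac Bc AB; apply: contrapT => /not_orP[nA nB].
have notsub Z : zclosed Z -> ~ curve b p `<=` Z ->
    exists2 f, (forall q, Z (chart m b q) -> evalA2 f q = 0) & ~ mdivides p f.
  move=> Zc nZ; apply: contrapT => H; apply: nZ; apply: curve_sub => // q pq.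
  have [S SE] := Zc b; rewrite -[Z _]/((chart m b @^-1` Z) q) SE => f Sf.
  apply: contrapT => fq; apply: H; exists f.
    by move=> q'; rewrite -[Z _]/((chart m b @^-1` Z) q') SE; apply.
  by move=> [s fE]; apply: fq; rewrite fE evalA2M pq mulr0.
have [f Af pf] := notsub _ Ac nA; have [g Bg pg] := notsub _ Bc nB.
have : mdivides p (f * g).
  apply: irreducible_nullstellensatz => // q pq; rewrite evalA2M.
  have : (A `|` B) (chart m b q) by apply: AB; apply/curve_chart.
  by case=> [/Af|/Bg] ->; rewrite ?mul0r ?mulr0.
by move=> /(irreducible_prime pirr)[].
Qed.

(** Some nonzero f vanishes on the trace of W. Irreducibility of W places it in the curve of an
    irreducible factor or in that of the cofactor, which is smaller. *)
Lemma zirreducible_sub_curve b W : zirreducible W -> W <> setT ->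
  meets_chart b W -> exists2 p, irreducible_mpoly p & W `<=` curve b p.
Proof.
move=> Wirr WT Wb; have [_ Wc _] := Wirr; have [S SE] := Wc b.
have [f Sf f0] : exists2 f, S f & f != 0.
  apply: contrapT => nS; apply: WT; apply: (zclosed_dense Wc (b := b)) => q.
  rewrite -[W _]/((chart m b @^-1` W) q) SE => f Sf.
  have [->|f0] := eqVneq f 0; first by rewrite /evalA2 meval0.
  by case: nS; exists f.
have : forall q, W (chart m b q) -> evalA2 f q = 0.
  by move=> q; rewrite -[W _]/((chart m b @^-1` W) q) SE; apply.
move: f0; elim/ltn_ind: {f Sf}(msize f) {-2}f (erefl (msize f)) => n IH f fn f0 Wf.
have fU : f \isn't a GRing.unit.
  have [q Wq] := Wb; apply/negP => /unitrP[g [_ fg]].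
  have := evalA2M f g q; rewrite fg (Wf _ Wq) mul0r /evalA2 meval1 => /eqP.
  by rewrite oner_eq0.
have [p pirr [s fE]] := irreducible_factor f0 fU; have [p0 pU _] := pirr.
have s0 : s != 0 by apply: contraNneq f0 => s0; rewrite fE s0 mul0r.
case: (@zirreducible_sub W (curve b s) (curve b p) b) => //;
  try exact: zclosed_curve.
- by move=> q /Wf/eqP; rewrite fE evalA2M mulf_eq0 => /orP[]/eqP ?; [left|right];
    apply/curve_chart.
- move=> Ws; apply: (IH _ _ _ erefl s0) => [|q /Ws/curve_chart //].
  by rewrite -fn fE; exact: msize_lt_mul_nonunit.
- by exists p.
Qed.

Lemma curve_associate b p (q : {mpoly K[2]}) :
  irreducible_mpoly p -> irreducible_mpoly q ->
  curve b p `<=` curve b q -> curve b p = curve b q.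
Proof.
move=> pirr qirr pq; apply/seteqP; split=> //.
have [s qE] : mdivides p q.
  apply: irreducible_nullstellensatz => // x px.
  by have /pq/curve_chart : curve b p (chart m b x) by apply/curve_chart.
have [_ pU _] := pirr; have [_ _ irr] := qirr.
case: (irr _ _ qE) => [sU|]; last by rewrite (negPf pU).
have pE : p = s^-1 * q by rewrite qE mulKr.
apply: curve_sub; first exact: zclosed_curve.
by move=> x qx; apply/curve_chart; rewrite pE evalA2M qx mulr0.
Qed.

Lemma prime_divisor_curve b p : irreducible_mpoly p -> prime_divisor (curve b p).
Proof.
move=> pirr; split; [exact: zirreducible_curve|exact: curve_neqT|].
move=> W Wirr pW; have [->|WT] := pselect (W = setT); [by right|left].
have [q0 pq0] := meets_chart_curve b pirr.
have Wb : meets_chart b W by exists q0; apply: pW.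
have [q qirr Wq] := zirreducible_sub_curve Wirr WT Wb.
have pqE : curve b p = curve b q.
  by apply: curve_associate => // z /pW/Wq.
by apply/seteqP; split=> // z /Wq; rewrite pqE.
Qed.

Lemma prime_divisorE b Z : prime_divisor Z -> meets_chart b Z ->
  exists2 p, irreducible_mpoly p & Z = curve b p.
Proof.
move=> [Zirr ZT Zmax] Zb; have [p pirr Zp] := zirreducible_sub_curve Zirr ZT Zb.
exists p => //; case: (Zmax _ (zirreducible_curve b pirr) Zp) => // /curve_neqT.
by [].
Qed.

Lemma meets_some_chart Z : prime_divisor Z -> exists b, meets_chart b Z.
Proof.
by move=> [[[z Zz] _ _] _ _]; have [b [q zE]] := exists_chart z; exists b, q;
  rewrite /preimage /= -zE.
Qed.

Lemma curve_generates b p : irreducible_mpoly p ->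
  generates_ideal p (chart m b @^-1` curve b p).
Proof.
move=> pirr f; split=> [H|[s ->] q /curve_chart pq]; last first.
  by rewrite evalA2M pq mulr0.
by apply: irreducible_nullstellensatz => // q pq; apply/H/curve_chart.
Qed.

End Topology.
Arguments curve {K} m b p.

(** * Orders along prime divisors *)

Section Divisors.
Variables (K : closedFieldType) (m : nat).
Local Notation hirz := (hirzebruch K m).
Implicit Types (f g p : {mpoly K[2]}) (H : {mpoly K[4]}) (b : bool * bool).
Implicit Types (Z A B W : set hirz) (q : K * K) (C D : divisor K m).

Lemma mdivides_exp f g k : mdivides f g -> mdivides (f ^+ k) (g ^+ k).
Proof. by move=> [s ->]; exists (s ^+ k); rewrite exprMn. Qed.

(** Two generators of the ideal of the trace divide each other, so the order may be computed with
    p. *)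
Lemma ord_along_curve b p f n : irreducible_mpoly p ->
  ord_along b (curve m b p) f n <->
  exists k : nat, [/\ n = k%:Z, mdivides (p ^+ k) f & ~ mdivides (p ^+ k.+1) f].
Proof.
move=> pirr; have gp := @curve_generates K m b p pirr; split.
  move=> [pi [k [gpi -> kf nkf]]]; exists k.
  have pip : mdivides pi p by apply/gpi/gp/mdivides_refl.
  have ppi : mdivides p pi by apply/gp/gpi/mdivides_refl.
  split; first by [].
    by apply: mdivides_trans kf; exact: mdivides_exp.
  by move=> H; apply: nkf; apply: mdivides_trans H; exact: mdivides_exp.
by move=> [k [-> kf nkf]]; exists p, k.
Qed.

Lemma ord_along_uniq b Z f n n' : prime_divisor Z -> meets_chart b Z ->
  ord_along b Z f n -> ord_along b Z f n' -> n = n'.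
Proof.
move=> Zp Zb; have [p pirr ->] := prime_divisorE Zp Zb.
move=> /(ord_along_curve _ _ _ pirr)[k [-> kf nkf]].
move=> /(ord_along_curve _ _ _ pirr)[l [-> lf nlf]]; congr (_%:Z).
apply/eqP; rewrite eqn_leq; apply/andP; split; rewrite leqNgt; apply/negP => lt.
  by apply: nlf; apply: mdivides_trans kf; exact: mdivides_exp_le.
by apply: nkf; apply: mdivides_trans lf; exact: mdivides_exp_le.
Qed.

Lemma mdivides_exp_msize p f k : irreducible_mpoly p -> f != 0 ->
  mdivides (p ^+ k) f -> (k < msize f)%N.
Proof.
move=> [p0 pU _] f0 [s fE]; have s0 : s != 0.
  by apply: contraNneq f0 => s0; rewrite fE s0 mul0r.
suff kp : (k < msize (p ^+ k))%N.
  have arith (x y : nat) : x != 0%N -> (k < y -> k < (x + y).-1)%N by lia.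
  by rewrite fE msizeM ?expf_neq0 //; apply: arith; rewrite ?msize_poly_eq0.
elim: k {fE} => [|k IH]; first by rewrite expr0 msize1.
by rewrite exprSr (leq_ltn_trans IH) // msize_lt_mul_nonunit // expf_neq0.
Qed.

Lemma ord_along_exists b Z f : prime_divisor Z -> meets_chart b Z -> f != 0 ->
  exists k : nat, ord_along b Z f k%:Z.
Proof.
move=> Zp Zb f0; have [p pirr ->] := prime_divisorE Zp Zb.
pose P k := `[< mdivides (p ^+ k) f >].
have P0 : exists k, P k by exists 0%N; apply/asboolP; exists f; rewrite expr0 mulr1.
have Pub k : P k -> (k <= msize f)%N.
  by move=> /asboolP/(mdivides_exp_msize pirr f0)/ltnW.
have [k /asboolP Pk kmax] := ex_maxnP P0 Pub; exists k.
apply/ord_along_curve => //; exists k; split=> // Pk1.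
by have := kmax k.+1 (introT (asboolP _) Pk1); rewrite ltnn.
Qed.

Lemma ord_along_neq0 b Z f n : ord_along b Z f n -> f != 0.
Proof.
move=> [pi [k [_ _ _ nkf]]]; apply/eqP => f0; apply: nkf; exists 0.
by rewrite mul0r.
Qed.

Lemma ord_along_mul b Z f g n n' : prime_divisor Z -> meets_chart b Z ->
  ord_along b Z f n -> ord_along b Z g n' -> ord_along b Z (f * g) (n + n').
Proof.
move=> Zp Zb; have [p pirr ->] := prime_divisorE Zp Zb.
move=> /(ord_along_curve _ _ _ pirr)[k [-> [s fE] nkf]].
move=> /(ord_along_curve _ _ _ pirr)[l [-> [t gE] nlf]].
apply/ord_along_curve => //; exists (k + l)%N; rewrite PoszD; split=> //.
  by exists (s * t); rewrite fE gE exprD mulrACA.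
rewrite fE gE mulrACA -exprD exprS [p * _]mulrC [_ * p ^+ _]mulrC.
move=> /mdivides_cancel; case: pirr => p0 pU pirr'; rewrite expf_neq0 // => /(_ isT).
move=> /irreducible_prime[] // [u E].
  by apply: nkf; exists u; rewrite fE E exprS mulrA.
by apply: nlf; exists u; rewrite gE E exprS mulrA.
Qed.

Lemma ord_along_unit b Z f : prime_divisor Z -> meets_chart b Z ->
  f \is a GRing.unit -> ord_along b Z f 0.
Proof.
move=> Zp Zb fU; have [p pirr ->] := prime_divisorE Zp Zb.
apply/ord_along_curve => //; exists 0%N; split=> //.
  by exists f; rewrite expr0 mulr1.
rewrite expr1 => -[s E]; have [_ + _] := pirr; apply/negP/negPn.
by move: fU; rewrite E unitrM => /andP[].
Qed.

Lemma ord_along_exp b Z f n k : prime_divisor Z -> meets_chart b Z ->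
  ord_along b Z f n -> ord_along b Z (f ^+ k) (k%:Z * n).
Proof.
move=> Zp Zb fn; elim: k => [|k IH].
  by rewrite mul0r; apply: ord_along_unit; rewrite ?unitr1.
by rewrite exprS intS mulrDl mul1r; apply: ord_along_mul.
Qed.

Lemma ord_along_pos b p f n : irreducible_mpoly p -> mdivides p f ->
  ord_along b (curve m b p) f n -> 0 < n.
Proof.
by move=> pirr pf /(ord_along_curve _ _ _ pirr)[[|k] [-> // _ []]].
Qed.

Lemma divides_of_ord b f g : f != 0 -> g != 0 ->
  (forall Z n n', prime_divisor Z -> meets_chart b Z ->
     ord_along b Z f n -> ord_along b Z g n' -> n <= n') ->
  mdivides f g.
Proof.
move=> f0 g0 H; apply: divides_of_prime_powers => // p k pirr kf.
have Zp := @prime_divisor_curve K m b p pirr.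
have Zb := @meets_chart_curve K m b p pirr.
have [n fn] := ord_along_exists Zp Zb f0.
have [n' gn'] := ord_along_exists Zp Zb g0.
have := H _ _ _ Zp Zb fn gn'.
move/(ord_along_curve _ _ _ pirr): fn => [_ [[<-] _ nf]].
move/(ord_along_curve _ _ _ pirr): gn' => [_ [[<-] gn' _]] nn'.
apply: mdivides_trans gn'; apply: mdivides_exp_le; rewrite leqNgt; apply/negP => lt.
apply: nf; apply: mdivides_trans kf; apply: mdivides_exp_le.
by move: nn'; rewrite lez_nat => nn'; exact: leq_ltn_trans lt.
Qed.

(** Otherwise the trace of Z on b' would lie in the complement of b, and irreducibility would put
    all of Z there. *)
Lemma meets_both b b' Z : zirreducible Z -> meets_chart b Z ->
  meets_chart b' Z ->
  exists q, Z (chart m b' q) /\ ~ chart_complement b (chart m b' q).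
Proof.
move=> Zirr [q0 Zq0] Zb'; apply: contrapT => H.
have Cc := zclosed_zero_locus (bihomog_unit_coord K m b).
case: (@zirreducible_sub K m Z _ _ b' Zirr Zb' Cc Cc) => [q Zq||].
- by left; apply: contrapT => qb; apply: H; exists q.
- by move=> /(_ _ Zq0); apply/in_chart; exists q0.
- by move=> /(_ _ Zq0); apply/in_chart; exists q0.
Qed.

(** With s p^k the restriction of H to b, let S and P be homogenizations of s and p. On b' the forms
    H and S P^k agree up to powers of the unit coordinates of b, and p' divides the restriction of P
    because P vanishes on the common curve. *)
Lemma prime_power_transition b b' (p p' : {mpoly K[2]}) H k :
  irreducible_mpoly p -> irreducible_mpoly p' -> curve m b p = curve m b' p' ->
  bihomog m H -> mdivides (p ^+ k) (dehomogenize b H) ->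
  mdivides (p' ^+ k) (dehomogenize b' H).
Proof.
move=> pirr p'irr E Hh [s sE].
have [dP [eP [P [Pd PE]]]] := exists_homogenization m b p.
have [dS [eS [S [Sd SE]]]] := exists_homogenization m b s.
have [d [e Hd]] := Hh.
have p'P : mdivides p' (dehomogenize b' P).
  apply: irreducible_nullstellensatz => // q p'q.
  have Ph : bihomog m P by exists dP, eP.
  apply/(zero_locus_chart _ _ Ph).
  have : curve m b' p' (chart m b' q) by apply/curve_chart.
  rewrite -E; apply: curve_sub; first exact: zclosed_zero_locus.
  by move=> q' pq'; apply/(zero_locus_chart _ _ Ph); rewrite PE.
have Qd := bihomogeneousM Sd (bihomogeneousX (n := k) Pd).
have EQ : dehomogenize b H = dehomogenize b (S * P ^+ k).
  by rewrite dehomogenizeM dehomogenizeX PE SE.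
pose w := weight m b d e - weight m b (dS + k * dP) (eS + k%:Z * eP).
(* The difference of weights may have either sign, so a power is allowed on both sides. *)
have [n1 [n2 n12]] : exists n1 n2 : nat, n1%:Z - n2%:Z = w.
  case: (w) => n; first by exists n, 0%N; rewrite subr0.
  by exists 0%N, n.+1; rewrite sub0r NegzE.
have := dehomogenize_transfer b' Hd Qd EQ n12.
rewrite !dehomogenizeM !dehomogenizeX => E2.
set w1 := _ ^+ (dS + _) * _ in E2.
have w1H : mdivides (p' ^+ k) (w1 * dehomogenize b' H).
  by rewrite E2 !mulrA; apply/mdivides_mull/mdivides_exp.
(* The prime p' does not divide w1: the common curve has a point in both charts, where the unit
   coordinates of b do not vanish. *)
apply: mdivides_exp_cancel w1H => //.
have Zb' := @meets_chart_curve K m b' p' p'irr.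
have Zb := @meets_chart_curve K m b p pirr; rewrite E in Zb.
have [q [Zq qb]] := meets_both (zirreducible_curve m b' p'irr) Zb Zb'.
move=> [t tE]; apply: qb.
rewrite /chart_complement zero_locus_chart; last exact: bihomog_unit_coord.
move/curve_chart: Zq => p'q.
have : evalA2 w1 q = 0 by rewrite tE evalA2M p'q mulr0.
rewrite /w1 evalA2M !evalA2X dehomogenizeM evalA2M => /eqP.
rewrite mulf_eq0 !expf_eq0 => /orP[/andP[_ /eqP ->]|/andP[_ /eqP ->]];
  by rewrite ?mul0r ?mulr0.
Qed.

Lemma ord_along_transition b b' Z H n : prime_divisor Z ->
  meets_chart b Z -> meets_chart b' Z -> bihomog m H ->
  ord_along b Z (dehomogenize b H) n -> ord_along b' Z (dehomogenize b' H) n.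
Proof.
move=> Zp Zb Zb' Hh.
have [p pirr ZE] := prime_divisorE Zp Zb.
have [p' p'irr ZE'] := prime_divisorE Zp Zb'.
rewrite {1}ZE ZE' => /(ord_along_curve _ _ _ pirr)[k [-> kf nkf]].
apply/(ord_along_curve _ _ _ p'irr); exists k; split; first by [].
  by apply: prime_power_transition kf => //; rewrite -ZE.
move=> /(@prime_power_transition b' b p' p); rewrite -ZE -ZE'.
by move=> /(_ p'irr pirr erefl Hh).
Qed.

Lemma irreducibleXU (i : 'I_2) : irreducible_mpoly ('X_i : {mpoly K[2]}).
Proof.
split; first by rewrite -msize_poly_eq0 msizeX.
  by rewrite mpoly_unitE msizeX mdeg1.
move=> s t E; have X0 : ('X_i : {mpoly K[2]}) != 0.
  by rewrite -msize_poly_eq0 msizeX.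
have /andP[s0 t0] : (s != 0) && (t != 0) by rewrite -negb_or -mulf_eq0 -E.
have := msizeM s0 t0; rewrite -E msizeX mdeg1 !mpoly_unitE.
have arith (x y : nat) : x != 0%N -> y != 0%N -> 2 = (x + y).-1 ->
    x == 1%N \/ y == 1%N.
  by lia.
by apply: arith; rewrite msize_poly_eq0.
Qed.

(** The zero polynomial has no order, and some prime divisor meets the chart, for instance the
    closure of x = 0. *)
Lemma local_equation_neq0 D b f : local_equation D b f -> f != 0.
Proof.
move=> Df; have Xirr := irreducibleXU 0.
have Xp := prime_divisor_curve m b Xirr.
exact: ord_along_neq0 (Df _ Xp (meets_chart_curve m b Xirr)).
Qed.

Lemma local_equation_uniq D b f g : local_equation D b f ->
  local_equation D b g -> exists2 c : K, c != 0 & g = c *: f.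
Proof.
move=> Df Dg; have f0 := local_equation_neq0 Df; have g0 := local_equation_neq0 Dg.
by apply: mdivides_anti => //; apply: (@divides_of_ord b) => // Z n n' Zp Zb fn gn;
  rewrite (ord_along_uniq Zp Zb fn (_ : ord_along b Z _ (D Z))) ?
   (ord_along_uniq Zp Zb gn (_ : ord_along b Z _ (D Z))) //; auto.
Qed.

Lemma finite_irreducible_factors b f : f != 0 ->
  finite_set [set Z | exists p, [/\ irreducible_mpoly p, mdivides p f &
                                   Z = curve m b p]].
Proof.
elim/ltn_ind: {f}(msize f) {-2}f (erefl (msize f)) => n IH f fn f0.
have [fU|fU] := boolP (f \is a GRing.unit).
  apply: (sub_finite_set _ (finite_set0 _)) => Z [p [[_ + _] [s fE] _]].
  by move: fU; rewrite fE unitrM => /andP[_ ->].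
have [p pirr [s fE]] := irreducible_factor f0 fU; have [p0 pU _] := pirr.
have s0 : s != 0 by apply: contraNneq f0 => s0; rewrite fE s0 mul0r.
have ltsn : (msize s < n)%N.
  by rewrite -fn fE; exact: msize_lt_mul_nonunit.
apply: (sub_finite_set _ (_ : finite_set ([set curve m b p] `|`
  [set Z | exists p, [/\ irreducible_mpoly p, mdivides p s & Z = curve m b p]]))).
  move=> Z [p' [p'irr]]; rewrite fE => /irreducible_prime[//|p's|[t pE]] ZE.
    by right; exists p'.
  left; rewrite /= ZE; apply: curve_associate => //.
  apply: curve_sub; first exact: zclosed_curve.
  by move=> q p'q; apply/curve_chart; rewrite pE evalA2M p'q mulr0.
by rewrite finite_setU; split; [exact: finite_set1|exact: IH ltsn _ erefl s0].
Qed.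

Lemma exists_divisor_of_zeros b H : bihomog m H -> dehomogenize b H != 0 ->
  exists C, effective C /\ divisor_of_zeros H C.
Proof.
move=> Hh Hb0; have H0 b' : dehomogenize b' H != 0.
  apply: contraNneq Hb0 => Hb'; have [d [e Hd]] := Hh.
  by apply/eqP; exact: dehomogenize_eq0 Hd Hb'.
(* The coefficient is the order in any chart that Z meets; the value 0 off the prime divisors is
   imposed by [is_divisor]. *)
have /choice[C HC] : forall Z, exists n : int,
    (prime_divisor Z -> forall b', meets_chart b' Z ->
       ord_along b' Z (dehomogenize b' H) n) /\
    (~ prime_divisor Z -> n = 0).
  move=> Z; have [Zp|Zp] := pselect (prime_divisor Z); last by exists 0.
  have [b' Zb'] := meets_some_chart Zp.
  have [k Hk] := ord_along_exists Zp Zb' (H0 b'); exists k%:Z; split; last by [].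
  by move=> _ b'' Zb''; exact: ord_along_transition Zp Zb' Zb'' Hh Hk.
have Cord Z b' : prime_divisor Z -> meets_chart b' Z ->
    ord_along b' Z (dehomogenize b' H) (C Z) by move=> Zp; exact: (HC Z).1.
exists C; split; last by move=> b' Z Zp Zb'; exact: Cord.
split; first split.
- by move=> Z /eqP CZ; apply: contrapT => /(HC Z).2.
- pose S b' := [set Z | exists p, [/\ irreducible_mpoly p,
    mdivides p (dehomogenize b' H) & Z = curve m b' p]].
  apply: (sub_finite_set _ (_ : finite_set
    ((S (true, true) `|` S (true, false)) `|`
     (S (false, true) `|` S (false, false))))).
    move=> Z /= CZ; have Zp : prime_divisor Z.
      by apply: contrapT => /(HC Z).2 CZ0; rewrite CZ0 eqxx in CZ.
    have [b' Zb'] := meets_some_chart Zp; have [p pirr ZE] := prime_divisorE Zp Zb'.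
    have := Cord _ _ Zp Zb'; rewrite {1}ZE => /(ord_along_curve _ _ _ pirr).
    move=> [[|k] [CZk kf _]]; first by rewrite CZk eqxx in CZ.
    have : S b' Z.
      exists p; split=> //; apply: mdivides_trans kf.
      by exists (p ^+ k); rewrite exprSr.
    move: b' {Zb' ZE kf} => [[] []] /=;
      by [left; left|left; right|right; left|right; right].
  have SF b' : finite_set (S b') by exact: finite_irreducible_factors (H0 b').
  by rewrite !finite_setU; split; split.
- move=> Z; have [Zp|/(HC Z).2 -> //] := pselect (prime_divisor Z).
  have [b' Zb'] := meets_some_chart Zp.
  by have [pi [k [_ -> _ _]]] := Cord _ _ Zp Zb'.
Qed.

Lemma ord_along_self b p : irreducible_mpoly p -> ord_along b (curve m b p) p 1.
Proof.
move=> pirr; apply/(ord_along_curve _ _ _ pirr); exists 1%N; split; first by [].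
  exact: mdivides_refl.
move=> [s]; have [p0 pU _] := pirr.
rewrite expr2 mulrA -{1}[p]mul1r => /(mulIf p0) E.
by move: pU; apply/negP/negPn/unitrP; exists s; rewrite [p * s]mulrC -E.
Qed.

Lemma curve_divisor b p f : irreducible_mpoly p -> irreducible_mpoly f ->
  mdivides p f -> curve m b p = curve m b f.
Proof.
move=> pirr firr [t fE]; apply: curve_associate => //.
apply: curve_sub; first exact: zclosed_curve.
by move=> q pq; apply/curve_chart; rewrite fE evalA2M pq mulr0.
Qed.

(** * Forms whose divisor is prime, applied to S_+ and to the fiber y_1 = 0 *)

Section PrimeForm.
Variables (b0 : bool * bool) (H : {mpoly K[4]}).
Hypothesis Hh : bihomog m H.
Hypothesis Hirr : irreducible_mpoly (dehomogenize b0 H).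
Hypothesis Hcharts : forall b, dehomogenize b H \is a GRing.unit \/
  irreducible_mpoly (dehomogenize b H) /\
  exists q, evalA2 (dehomogenize b H) q = 0 /\
    ~ chart_complement b0 (chart m b q).

(** A chart where H is a unit contributes no zero. In any other chart, the zero lying also in b0
    shows that the curve closed up from b0 meets the chart; its local equation divides the
    irreducible restriction of H, so it gives all zeros there. *)
Lemma zero_locus_prime_form : zero_locus H = curve m b0 (dehomogenize b0 H).
Proof.
apply/seteqP; split=> z; last first.
  apply: curve_sub; first exact: zclosed_zero_locus.
  by move=> q Hq; apply/(zero_locus_chart _ _ Hh).
have [b [q ->]] := exists_chart z => /(zero_locus_chart _ _ Hh) Hq.
case: (Hcharts b) => [/unitrP[g [_ Hg]]|[Hbirr [q1 [Hq1 /in_chart[q2 q12]]]]].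
  have := evalA2M (dehomogenize b H) g q; rewrite Hg Hq mul0r /evalA2 meval1.
  by move=> /eqP; rewrite oner_eq0.
set Z := curve _ _ _.
have Zp : prime_divisor Z by exact: prime_divisor_curve.
have Zb0 : meets_chart b0 Z by exact: meets_chart_curve.
have Zb : meets_chart b Z.
  exists q1; rewrite /preimage /= q12; apply/curve_chart/(zero_locus_chart _ _ Hh).
  by rewrite -q12; apply/(zero_locus_chart _ _ Hh).
have [p pirr ZE] := prime_divisorE Zp Zb.
have := ord_along_transition Zp Zb0 Zb Hh (ord_along_self b0 Hirr).
rewrite ZE => /(ord_along_curve _ _ _ pirr)[_ [[<-] pH _]].
by rewrite (curve_divisor b pirr Hbirr pH); apply/curve_chart.
Qed.

Lemma prime_divisor_prime_form : prime_divisor (zero_locus H : set hirz).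
Proof. by rewrite zero_locus_prime_form; exact: prime_divisor_curve. Qed.

Lemma local_equation_prime_form b :
  local_equation (mult_prime 1 (zero_locus H : set hirz)) b (dehomogenize b H).
Proof.
move=> Z Zp Zb; rewrite /mult_prime; case: asboolP => [ZE|ZE].
  have Zb0 : meets_chart b0 Z.
    by rewrite ZE zero_locus_prime_form; exact: meets_chart_curve.
  apply: (ord_along_transition Zp Zb0 Zb Hh).
  by rewrite ZE zero_locus_prime_form; exact: ord_along_self.
case: (Hcharts b) => [HU|[Hbirr _]]; first exact: ord_along_unit.
have [p pirr pE] := prime_divisorE Zp Zb.
have H0 : dehomogenize b H != 0 by case: Hbirr.
have [k Hk] := ord_along_exists Zp Zb H0.
suff k0 : k = 0%N by rewrite k0 in Hk.
move: Hk; rewrite {1}pE => /(ord_along_curve _ _ _ pirr)[_ [[<-] pH _]].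
case: k pH => [//|k]; rewrite exprSr => pH; case: ZE.
have {}pH : mdivides p (dehomogenize b H).
  by apply: mdivides_trans pH; exists (p ^+ k).
have [Lirr LT _] := prime_divisor_prime_form; have [_ _ Zmax] := Zp.
case: (Zmax _ Lirr) => // z; rewrite pE (curve_divisor b pirr Hbirr pH).
apply: curve_sub; first exact: zclosed_zero_locus.
by move=> q Hq; apply/(zero_locus_chart _ _ Hh).
Qed.

End PrimeForm.

End Divisors.

(** * Divisors linearly equivalent to a S_+ *)

(** The weights of the vertices are forced to be i/a and j/b, so the triangle is i/a + j/b <= 1 with
    denominators cleared. *)
Lemma in_triangleP (a b i j : nat) : (0 < a)%N -> (0 < b)%N ->
  in_triangle a b i j <-> (i * b + j * a <= a * b)%N.
Proof.
move=> a0 b0; have a0' : (a%:R : rat) != 0 by rewrite Num.Theory.pnatr_eq0 -lt0n.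
have b0' : (b%:R : rat) != 0 by rewrite Num.Theory.pnatr_eq0 -lt0n.
split=> [[s [t [s0 t0 st iE jE]]]|H].
  rewrite -(Num.Theory.ler_nat rat) natrD !natrM iE jE.
  rewrite (_ : _ + _ = (s + t) * (a%:R * b%:R)); last by ring.
  by rewrite Num.Theory.ler_piMl // Num.Theory.mulr_ge0 // Num.Theory.ler0n.
exists (i%:R / a%:R), (j%:R / b%:R); split.
- by rewrite Num.Theory.divr_ge0 // Num.Theory.ler0n.
- by rewrite Num.Theory.divr_ge0 // Num.Theory.ler0n.
- rewrite addf_div // Num.Theory.ler_pdivrMr ?mul1r.
    by rewrite -!natrM -natrD Num.Theory.ler_nat.
  by rewrite Num.Theory.mulr_gt0 // Num.Theory.ltr0n.
- by rewrite divfK.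
- by rewrite divfK.
Qed.

(** Distinct exponents stay distinct, so no terms merge or cancel. *)
Lemma mcoeff_sum_monomials (K : fieldType) n (f : {mpoly K[2]})
    (phi : 'X_{1..2} -> 'X_{1..n}) (k : 'X_{1..2}) : k \in msupp f ->
  {in msupp f &, injective phi} ->
  (\sum_(l <- msupp f) f@_l *: 'X_[phi l])@_(phi k) = f@_k.
Proof.
move=> kf inj; rewrite raddf_sum (bigD1_seq k) //= ?msupp_uniq //.
rewrite mcoeffZ mcoeffX eqxx mulr1 big_seq_cond big1 ?addr0 // => l /andP[lf lk].
rewrite mcoeffZ mcoeffX; case: eqP => [/inj lkE|]; last by rewrite mulr0.
by rewrite lkE ?eqxx in lk.
Qed.

Lemma cancel_common_factor (A : idomainType) (u v p q h : A) (a d n k l : nat) :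
  u != 0 -> h != 0 ->
  u ^+ (a + d) * v ^+ k * (p * h) = u ^+ (n + d) * v ^+ l * (q * h) ->
  u ^+ a * v ^+ k * p = u ^+ n * v ^+ l * q.
Proof.
move=> u0 h0; rewrite !exprD => E; apply: (mulIf h0).
apply: (mulfI (expf_neq0 d u0)).
transitivity (u ^+ a * u ^+ d * v ^+ k * (p * h)); first by ring.
by rewrite E; ring.
Qed.

Lemma mdivides_XnMX (K : fieldType) n (i : 'I_n) (j l : nat) (p : {mpoly K[n]}) e :
  mdivides ('X_i ^+ j) ('X_i ^+ l * p) -> e \in msupp p -> (j <= l + e i)%N.
Proof.
move=> /mdivides_XnP H ep; have := H (U_(i) *+ l + e)%MM.
rewrite mnmDE mulmnE mnm1E eqxx mul1n; apply.
by rewrite mpolyXn mulrC mcoeff_msupp mcoeffMX -mcoeff_msupp.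
Qed.

Section LinearSystem.
Variables (K : closedFieldType) (m a : nat).
Hypotheses (m_gt0 : (0 < m)%N) (a_gt0 : (0 < a)%N).
Local Notation hirz := (hirzebruch K m).
Implicit Types (F : {mpoly K[2]}) (H : {mpoly K[4]}) (b : bool * bool).
Implicit Types (Z : set hirz) (C D : divisor K m).

Lemma bidegreeP F : bidegree a (a * m) F <->
  forall k, k \in msupp F -> (m * k 0%R + k 1%R <= a * m)%N.
Proof.
have am0 : (0 < a * m)%N by rewrite muln_gt0 a_gt0.
have E (i j : nat) : (i * (a * m) + j * a <= a * (a * m))%N = (m * i + j <= a * m)%N.
  by rewrite -[RHS](leq_pmul2r a_gt0); congr (_ <= _)%N; lia.
by split=> H k /H; rewrite in_triangleP // E.
Qed.

(** A term c x^i y^j of F becomes c x0^i x1^(a-i) y0^j y1^(m(a-i)-j): this is the polynomial G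
    attached to F. *)
Definition hirzebruch_form F : {mpoly K[4]} := homogenize m affine_chart a 0 F.

Lemma bidegree_fits F : bidegree a (a * m) F -> fits m affine_chart a 0 F.
Proof.
move=> /bidegreeP H k /H kE /=; have ka : (k 0%R <= a)%N.
  by rewrite -(leq_pmul2l m_gt0); lia.
by split=> //; rewrite add0n mulnBr; lia.
Qed.

Lemma bihomogeneous_form F : bidegree a (a * m) F ->
  bihomogeneous m a 0 (hirzebruch_form F).
Proof. by move=> /bidegree_fits; exact: bihomogeneous_homogenize. Qed.

Lemma bihomog_coord :
  bihomog m ('X_0 : {mpoly K[4]}) /\ bihomog m ('X_3 : {mpoly K[4]}).
Proof.
by have [E0 _ _ E3] := bihomogeneousXU K m; split; do 2!eexists; eassumption.
Qed.

Lemma Splus_charts b : dehomogenize b ('X_0 : {mpoly K[4]}) \is a GRing.unit \/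
  irreducible_mpoly (dehomogenize b ('X_0 : {mpoly K[4]})) /\
  exists q, evalA2 (dehomogenize b ('X_0 : {mpoly K[4]})) q = 0 /\
    ~ chart_complement affine_chart (chart m b q).
Proof.
have [E0 _ _ _] := dehomogenizeXU K b; rewrite E0.
case: b {E0} => [[] b2] /=; [by left; rewrite unitr1|right].
split; first exact: irreducibleXU.
(* This point of S_+ has both fiber coordinates y0 and y1 equal to 1, so it also lies in the affine
   chart. *)
exists (0, 1); rewrite evalA2XU; split=> //.
rewrite /chart_complement zero_locus_chart; last exact: bihomog_unit_coord.
rewrite dehomogenizeM !unit_coordE evalA2M /= => /eqP.
by case: b2; rewrite /evalA2 ?mevalXU ?meval1 mulr1 oner_eq0.
Qed.

Lemma fiber_charts b : dehomogenize b ('X_3 : {mpoly K[4]}) \is a GRing.unit \/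
  irreducible_mpoly (dehomogenize b ('X_3 : {mpoly K[4]})) /\
  exists q, evalA2 (dehomogenize b ('X_3 : {mpoly K[4]})) q = 0 /\
    ~ chart_complement (false, true) (chart m b q).
Proof.
have [_ _ _ E3] := dehomogenizeXU K b; rewrite E3.
case: b {E3} => [b1 []] /=; [right|by left; rewrite unitr1].
split; first exact: irreducibleXU.
(* Here x0 = x1 = 1, so the point of the fiber lies in both charts around it. *)
exists (1, 0); rewrite evalA2XU; split=> //.
rewrite /chart_complement zero_locus_chart; last exact: bihomog_unit_coord.
rewrite dehomogenizeM !unit_coordE evalA2M /= => /eqP.
by case: b1; rewrite /evalA2 ?mevalXU ?meval1 mulr1 oner_eq0.
Qed.

Lemma local_equation_Splus b :
  local_equation (mult_prime 1 (Splus : set hirz)) b (dehomogenize b 'X_0).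
Proof.
apply: (@local_equation_prime_form K m affine_chart); first exact: bihomog_coord.1.
  have [E0 _ _ _] := dehomogenizeXU K affine_chart; rewrite E0.
  exact: irreducibleXU.
exact: Splus_charts.
Qed.

Lemma fiber_irreducible :
  irreducible_mpoly (dehomogenize (false, true) ('X_3 : {mpoly K[4]})).
Proof.
have [_ _ _ E3] := dehomogenizeXU K (false, true); rewrite E3.
exact: irreducibleXU.
Qed.

Lemma local_equation_fiber b :
  local_equation (mult_prime 1 (fiber_y1 : set hirz)) b (dehomogenize b 'X_3).
Proof.
apply: (@local_equation_prime_form K m (false, true)); first exact: bihomog_coord.2.
  exact: fiber_irreducible.
exact: fiber_charts.
Qed.

Lemma fiber_y1E : fiber_y1 = curve m (false, true) ('X_1 : {mpoly K[2]}).
Proof.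
rewrite [LHS](zero_locus_prime_form bihomog_coord.2 fiber_irreducible fiber_charts).
by have [_ _ _ ->] := dehomogenizeXU K (false, true).
Qed.

Lemma ord_along_Splus b Z : prime_divisor Z -> meets_chart b Z ->
  ord_along b Z (dehomogenize b ('X_0 ^+ a)) (mult_prime a%:Z Splus Z).
Proof.
move=> Zp Zb; have := ord_along_exp a Zp Zb (local_equation_Splus Zp Zb).
by rewrite dehomogenizeX /mult_prime; case: asboolP => _; rewrite ?mulr1 ?mulr0.
Qed.

Lemma exists_divisor_of_bidegree F : F != 0 -> bidegree a (a * m) F ->
  exists C, [/\ effective C, linear_equiv C (mult_prime a%:Z Splus) &
                divisor_of_zeros (hirzebruch_form F) C].
Proof.
move=> F0 Fd; have Gd := bihomogeneous_form Fd.
have Gh : bihomog m (hirzebruch_form F) by exists a, 0.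
have [|C [Ce CG]] := @exists_divisor_of_zeros K m affine_chart _ Gh.
  by rewrite homogenizeK.
(* The rational function G / x0^a has divisor C - a S_+. *)
exists C; split=> //; exists a, 0, (hirzebruch_form F), ('X_0 ^+ a); split=> //.
- have [E0 _ _ _] := bihomogeneousXU K m.
  by have := bihomogeneousX (n := a) E0; rewrite muln1 mulr0.
- apply: contraNneq F0 => G0; rewrite -(homogenizeK m affine_chart a 0 F).
  by rewrite -/(hirzebruch_form F) G0 dehomogenize0.
- by rewrite expf_neq0 // -msize_poly_eq0 msizeX.
- move=> Z Zp b Zb; exists (C Z), (mult_prime a%:Z Splus Z); split=> //.
    exact: CG.
  exact: ord_along_Splus.
Qed.

(** On the chart, C is the divisor of s f / f'; being effective, it makes this quotient a
    polynomial. *)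
Lemma exists_local_quotient C D b f f' s : effective C -> local_equation D b s ->
  (forall Z, prime_divisor Z -> meets_chart b Z ->
     exists n n', [/\ ord_along b Z f n, ord_along b Z f' n' &
                      C Z - D Z = n - n']) ->
  f' != 0 /\ exists2 Q, local_equation C b Q & Q * f' = s * f.
Proof.
move=> [Cd C0] Ds Cf; have Xirr := @irreducibleXU K 0.
have Xp := prime_divisor_curve m b Xirr; have Xb := meets_chart_curve m b Xirr.
have [n [n' [/ord_along_neq0 f0 /ord_along_neq0 f'0 _]]] := Cf _ Xp Xb.
have s0 := local_equation_neq0 Ds.
have sf0 : s * f != 0 by rewrite mulf_neq0.
have ordsf Z : prime_divisor Z -> meets_chart b Z -> exists n n',
    [/\ ord_along b Z f' n', ord_along b Z (s * f) n & C Z + n' = n].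
  move=> Zp Zb; have [l [l' [fl f'l' E]]] := Cf Z Zp Zb.
  exists (D Z + l), l'; split=> //; first exact: ord_along_mul Zp Zb (Ds _ Zp Zb) fl.
  by rewrite -[C Z](subrK (D Z)) E; ring.
have [Q QE] : mdivides f' (s * f).
  apply: (@divides_of_ord K m b) => // Z k k' Zp Zb fk fk'.
  have [l [l' [fl' fl E]]] := ordsf Z Zp Zb.
  rewrite (ord_along_uniq Zp Zb fk fl') (ord_along_uniq Zp Zb fk' fl) -E.
  by rewrite Num.Theory.lerDr.
split=> //; exists Q => // Z Zp Zb.
have Q0 : Q != 0 by apply: contraNneq sf0 => Q0; rewrite QE Q0 mul0r.
have [k Qk] := ord_along_exists Zp Zb Q0.
have [l [l' [fl' fl E]]] := ordsf Z Zp Zb.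
have := ord_along_mul Zp Zb Qk fl'; rewrite -QE => /(ord_along_uniq Zp Zb fl).
by rewrite -E => /addIr ->.
Qed.

Lemma exists_form C : effective C -> linear_equiv C (mult_prime a%:Z Splus) ->
  exists F, [/\ F != 0, bidegree a (a * m) F &
                divisor_of_zeros (hirzebruch_form F) C].
Proof.
move=> Ce [d [e [H [H' [Hd H'd _ _ HC]]]]].
pose S b := dehomogenize b ('X_0 ^+ a : {mpoly K[4]}).
have quot b : dehomogenize b H' != 0 /\ exists2 Q, local_equation C b Q &
    Q * dehomogenize b H' = S b * dehomogenize b H.
  apply: (exists_local_quotient Ce (D := mult_prime a%:Z Splus)).
    by move=> Z Zp Zb; exact: ord_along_Splus.
  by move=> Z Zp Zb; exact: HC.
have [H'0 [F CF FE]] := quot affine_chart.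
have F0 := local_equation_neq0 CF.
(* The bidegree of F is not yet bounded by (a, 0), so a provisional bidegree (N, N) is used. *)
set N := msize F; pose P := homogenize m affine_chart N N F.
have Ffits : fits m affine_chart N N F.
  move=> k kF; split; first exact: mnm_le_msize.
  by apply: leq_trans (mnm_le_msize _ kF) _; rewrite leq_addr.
have Pd : bihomogeneous m N N (P : {mpoly K[4]}) by exact: bihomogeneous_homogenize.
have X0d : bihomogeneous m a 0 ('X_0 ^+ a : {mpoly K[4]}).
  have [E0 _ _ _] := bihomogeneousXU K m.
  by have := bihomogeneousX (n := a) E0; rewrite muln1 mulr0.
have PE : dehomogenize affine_chart (P * H') =
    dehomogenize affine_chart ('X_0 ^+ a * H).
  by rewrite !dehomogenizeM homogenizeK.
(* Both P and x0^a H / H' restrict to F on the affine chart. Elsewhere they differ by powers of x1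
   and y1, whose exponents come from the two bidegrees. *)
have trans b' Q :
    dehomogenize b' H' != 0 -> Q * dehomogenize b' H' = S b' * dehomogenize b' H ->
    dehomogenize b' 'X_1 ^+ a * dehomogenize b' 'X_3 ^+ (m * a) * dehomogenize b' P =
    dehomogenize b' 'X_1 ^+ N * dehomogenize b' 'X_3 ^+ (N + m * N) * Q.
  move=> Hb'0 QE.
  have := dehomogenize_transfer b' (n1 := N + m * N) (n2 := m * a)
    (bihomogeneousM Pd H'd) (bihomogeneousM X0d Hd) PE.
  have -> : (N + m * N)%N%:Z - (m * a)%N%:Z =
      weight m affine_chart (N + d) (N%:Z + e) -
      weight m affine_chart (a + d) (0 + e).
    by rewrite /weight /=; lia.
  move=> /(_ erefl).
  rewrite !dehomogenizeM -/(S b') -QE !dehomogenizeX.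
  exact: cancel_common_factor (dehomogenize_unit_coordx_neq0 _ _ _) Hb'0.
have Fd : bidegree a (a * m) F.
  apply/bidegreeP => k kF; have [kN kN'] := Ffits k kF.
  (* In the chart [1:x;y:1], [trans] reads x^a P = x^N Q1, and the monomial k of F has become one
     with x-exponent N - k0; thus N <= a + N - k0. In [x:1;1:y] it reads y^(ma) P = y^(N+mN) Q2,
     with y-exponent N + m(N - k0) - k1, which gives m k0 + k1 <= ma. *)
  have [H'1 [Q1 _ Q1E]] := quot (true, false).
  have [H'2 [Q2 _ Q2E]] := quot (false, true).
  have := trans _ _ H'1 Q1E; have := trans _ _ H'2 Q2E.
  have [_ E1 _ E3] := dehomogenizeXU K (true, false).
  have [_ E1' _ E3'] := dehomogenizeXU K (false, true).
  rewrite E1 E3 E1' E3' /= !expr1n !mul1r !mulr1 !dehomogenize_homogenize.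
  (* Monomials of F do not collapse in either chart, so each of them is subject to the
     divisibility. *)
  have inj : {in msupp F &, injective (fun k : 'X_{1..2} => [multinom
      [tuple homogenize_monomial m affine_chart N N k 0;
             homogenize_monomial m affine_chart N N k 3]])}.
    move=> k1 k2 /Ffits[A1 A1'] /Ffits[A2 A2'] /eqP; rewrite eq_mnm2 !mnm2E.
    rewrite !homogenize_monomialE /= => /andP[/eqP e0 /eqP e1]; apply/eqP.
    by rewrite eq_mnm2 e0 eqxx /=; move: A1' A2' e1; rewrite /= e0; lia.
  have inj' : {in msupp F &, injective (fun k : 'X_{1..2} => [multinom
      [tuple homogenize_monomial m affine_chart N N k 1;
             homogenize_monomial m affine_chart N N k 2]])}.
    move=> k1 k2 /Ffits[A1 A1'] /Ffits[A2 A2'] /eqP; rewrite eq_mnm2 !mnm2E.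
    rewrite !homogenize_monomialE /= => /andP[/eqP e0 /eqP e1]; apply/eqP.
    by rewrite eq_mnm2 e1 eqxx andbT; move: A1 A2 e0; lia.
  move=> T2 T1.
  have supp2 := kF.
  rewrite mcoeff_msupp -(mcoeff_sum_monomials kF inj) -mcoeff_msupp in supp2.
  have supp1 := kF.
  rewrite mcoeff_msupp -(mcoeff_sum_monomials kF inj') -mcoeff_msupp in supp1.
  have D1 := mdivides_XnMX (i := 0) (j := N) (l := a) _ supp1.
  have {D1} := D1 (ex_intro _ Q1 (etrans T1 (mulrC _ _))).
  have D2 := mdivides_XnMX (i := 1) (j := N + m * N) (l := m * a) _ supp2.
  have {D2} := D2 (ex_intro _ Q2 (etrans T2 (mulrC _ _))).
  rewrite !mnm2E !homogenize_monomialE /= mulnBr => D2 D1.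
  have : (m * k 0%R <= m * N)%N by rewrite leq_mul2l kN orbT.
  by move: kN' D2; rewrite /= mulnBr; lia.
(* Now the form of F has the bidegree of x0^a H / H', so the two sides of the transfer carry the
   same power, which cancels. *)
exists F; split; [exact: F0 | exact: Fd |] => b.
have Gd := bihomogeneous_form Fd; have [Hb'0 [Q CQ QE]] := quot b.
have GE : dehomogenize affine_chart (hirzebruch_form F * H') =
    dehomogenize affine_chart ('X_0 ^+ a * H).
  by rewrite !dehomogenizeM homogenizeK; exact: FE.
have := dehomogenize_transfer b (n1 := 0) (n2 := 0)
    (bihomogeneousM Gd H'd) (bihomogeneousM X0d Hd) GE.
rewrite !subrr => /(_ erefl).
rewrite dehomogenizeM [RHS]dehomogenizeM => /mulfI E.
suff <- : Q = dehomogenize b (hirzebruch_form F) by [].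
apply: (mulIf Hb'0); rewrite QE -!dehomogenizeM; symmetry; apply: E.
rewrite expr0 mulr1 dehomogenizeX; apply: expf_neq0.
exact: dehomogenize_unit_coordx_neq0.
Qed.

(** Linear equivalence yields some form with divisor C. Its restriction to the affine chart has the
    same divisor as F, hence is F up to a constant, and so is the form itself. *)
Lemma divisor_of_zeros_form F C :
  bidegree a (a * m) F -> polynomial_divisor a F C ->
  F != 0 /\ divisor_of_zeros (hirzebruch_form F) C.
Proof.
move=> Fd [Ce Cl CF]; split; first exact: local_equation_neq0 CF.
have [F' [F'0 F'd CF']] := exists_form Ce Cl.
have := CF' affine_chart; rewrite homogenizeK => CF'0.
have [c c0 FE] := local_equation_uniq CF'0 CF => b Z Zp Zb.
have -> : hirzebruch_form F = c *: hirzebruch_form F'.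
  rewrite /hirzebruch_form /homogenize scaler_sumr FE.
  rewrite (perm_big _ (msuppZ _ c0)); apply: eq_bigr => k _.
  by rewrite mcoeffZ scalerA.
have [pi [k [gpi Ck kf nkf]]] := CF' b Z Zp Zb.
rewrite dehomogenizeZ.
by exists pi, k; split; rewrite ?mdividesZr.
Qed.

Lemma exists_unique_polynomial_divisor F : F != 0 -> bidegree a (a * m) F ->
  exists! C : divisor K m, polynomial_divisor a F C.
Proof.
move=> F0 Fd; have [C [Ce Cl CF]] := exists_divisor_of_bidegree F0 Fd.
have FC : polynomial_divisor a F C.
  by split=> //; have := CF affine_chart; rewrite homogenizeK.
exists C; split=> // C' FC'; have [_ C'F] := divisor_of_zeros_form Fd FC'.
have [[Cp _] _] := Ce; have [[[C'p _] _] _ _] := FC'.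
apply/funext => Z; have [Zp|Zp] := pselect (prime_divisor Z).
  have [b Zb] := meets_some_chart Zp.
  exact: ord_along_uniq Zp Zb (CF b Z Zp Zb) (C'F b Z Zp Zb).
have -> : C Z = 0 by apply/eqP/negPn/negP => /Cp.
by apply/esym/eqP/negPn/negP => /C'p.
Qed.

Lemma irreducible_of_irreducible_divisor F C : bidegree a (a * m) F ->
  polynomial_divisor a F C -> irreducible_divisor C -> irreducible_mpoly F.
Proof.
move=> Fd FC [Z [Zp CE]]; have [F0 CG] := divisor_of_zeros_form Fd FC.
have [_ _ CF] := FC.
(* As C is a single prime divisor Z, every prime factor of a local equation closes up to Z. *)
have factors b f p q : local_equation C b f -> irreducible_mpoly p ->
    irreducible_mpoly q -> mdivides p f -> mdivides q f ->
    curve m b p = curve m b q.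
  move=> Cf pirr qirr pf qf.
  suff E r : irreducible_mpoly r -> mdivides r f -> curve m b r = Z by rewrite !E.
  move=> rirr rf; have rp := prime_divisor_curve m b rirr.
  have := Cf _ rp (meets_chart_curve m b rirr).
  by move=> /(ord_along_pos rirr rf); rewrite CE /mult_prime; case: asboolP.
split=> //.
  (* For constant F the divisor would be a S_- plus ma times the fiber y_1 = 0: in the chart
     [1:x;1:y] its equation is x^a y^(ma), up to a constant, with two distinct prime factors. *)
  apply/negP => FU; have [c c0 FE] : exists2 c : K, c != 0 & F = c%:MP.
    by apply/msize_poly1P; rewrite -mpoly_unitE.
  have Xirr i := @irreducibleXU K i.
  have GE : dehomogenize (true, true) (hirzebruch_form F) =
      c *: ('X_0 ^+ a * 'X_1 ^+ (m * a)).
    rewrite /hirzebruch_form dehomogenize_homogenize FE msuppC (negPf c0).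
    rewrite big_seq1 mcoeffC eqxx mulr1.
    congr (_ *: _); rewrite mpolyXE_id prod_ord2 !mnm2E !homogenize_monomialE /=.
    by rewrite !mnm0E !subn0.
  have Cf := CG (true, true); rewrite GE in Cf.
  have : curve m (true, true) ('X_0 : {mpoly K[2]}) = curve m (true, true) 'X_1.
    apply: factors Cf (Xirr 0) (Xirr 1) _ _; apply/mdividesZr => //.
      by apply: mdivides_mulr; rewrite -{1}['X_0]expr1; exact: mdivides_exp_le.
    apply: mdivides_mull; rewrite -{1}['X_1]expr1; apply: mdivides_exp_le.
    by rewrite muln_gt0 m_gt0.
  have : curve m (true, true) ('X_0 : {mpoly K[2]}) (chart m (true, true) (0, 1)).
    by apply/curve_chart; rewrite evalA2XU.
  move=> + E; rewrite E => /curve_chart/eqP; rewrite evalA2XU /=.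
  by rewrite oner_eq0.
move=> s t FE; apply: contrapT => /not_orP[/negP sU /negP tU].
have s0 : s != 0 by apply: contraNneq F0 => s0; rewrite FE s0 mul0r.
have t0 : t != 0 by apply: contraNneq F0 => t0; rewrite FE t0 mulr0.
(* Prime factors p of s and q of t define the same curve, so p^2 divides F, while no coefficient of
   C exceeds 1. *)
have [p pirr [s' sE]] := irreducible_factor s0 sU.
have [q qirr [t' tE]] := irreducible_factor t0 tU.
have pF : mdivides p F by rewrite FE sE; exists (s' * t); rewrite mulrAC.
have qF : mdivides q F by rewrite FE tE; exists (s * t'); rewrite mulrA.
have pq := factors _ _ _ _ CF pirr qirr pF qF.
have [l ql] : mdivides p q.
  apply: irreducible_nullstellensatz => // x px.
  have : curve m affine_chart p (chart m affine_chart x) by apply/curve_chart.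
  by rewrite pq => /curve_chart.
have pp := prime_divisor_curve m affine_chart pirr.
have := CF _ pp (meets_chart_curve m affine_chart pirr).
move=> /(ord_along_curve _ _ _ _ pirr)[k [Ck _ nk]].
have k1 : (k <= 1)%N.
  by rewrite -lez_nat -Ck CE /mult_prime; case: asboolP.
apply: nk; apply: (mdivides_trans (g := p ^+ 2)); first exact: mdivides_exp_le.
by exists (s' * l * t'); rewrite FE sE tE ql; ring.
Qed.

End LinearSystem.

Arguments hirzebruch_form {K} m a F.

(** * Local intersection numbers *)

Section LocalRing.
Variables (K : fieldType) (q : K * K).
Implicit Types (f g h : {mpoly K[2]}) (x y : {fraction {mpoly K[2]}}).
Local Notation O := (local_ring q).

Lemma local_ring_tofrac f : O (tofrac f).
Proof.
by exists f, 1; rewrite /evalA2 meval1 oner_neq0 tofrac1 divr1.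
Qed.

Lemma eval_neq0 h : evalA2 h q != 0 -> tofrac h != 0.
Proof. by rewrite tofrac_eq0; apply: contraNneq => ->; rewrite /evalA2 meval0. Qed.

Lemma local_ringM x y : O x -> O y -> O (x * y).
Proof.
move=> [g [h [hq ->]]] [g' [h' [h'q ->]]]; exists (g * g'), (h * h').
by rewrite evalA2M mulf_neq0 // !tofracM invfM mulrACA.
Qed.

Lemma local_ringD x y : O x -> O y -> O (x + y).
Proof.
move=> [g [h [hq ->]]] [g' [h' [h'q ->]]]; exists (g * h' + g' * h), (h * h').
rewrite evalA2M mulf_neq0 //; split=> //.
by rewrite tofracD !tofracM addf_div //; exact: eval_neq0.
Qed.

Variables f g : {mpoly K[2]}.
Local Notation I := (local_ideal q f g).

Lemma local_ideal0 : I 0.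
Proof.
have O0 := local_ring_tofrac 0; rewrite tofrac0 in O0.
by exists 0, 0; rewrite !mul0r addr0.
Qed.

Lemma local_idealD x y : I x -> I y -> I (x + y).
Proof.
move=> [s [t [sO tO ->]]] [s' [t' [sO' tO' ->]]]; exists (s + s'), (t + t').
by split; [exact: local_ringD|exact: local_ringD|rewrite !mulrDl addrACA].
Qed.

Lemma local_idealM x y : O x -> I y -> I (x * y).
Proof.
move=> xO [s [t [sO tO ->]]]; exists (x * s), (x * t).
by split; [exact: local_ringM|exact: local_ringM|rewrite mulrDr !mulrA].
Qed.

Lemma local_idealN x : I x -> I (- x).
Proof.
move=> xI; rewrite -mulN1r -tofrac1 -tofracN.
by apply: local_idealM => //; exact: local_ring_tofrac.
Qed.

Lemma local_ideal_sum (J : Type) (r : seq J) (F : J -> {fraction {mpoly K[2]}}) :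
  (forall j, I (F j)) -> I (\sum_(j <- r) F j).
Proof.
move=> FI; elim/big_ind: _ => //; first exact: local_ideal0.
exact: local_idealD.
Qed.

Lemma local_idealB x y : I x -> I y -> I (x - y).
Proof. by move=> xI /local_idealN; exact: local_idealD. Qed.

(* Expanding one basis in another modulo the ideal gives matrices that are
   inverse to each other. *)
Lemma local_dim_le n n' : local_dim q f g n -> local_dim q f g n' -> (n <= n')%N.
Proof.
move=> [b [bO bP]] [b' [b'O b'P]].
have /choice[M MP] : forall i, exists c : {ffun 'I_n' -> K},
    I (b i - \sum_j tofrac (c j)%:MP * b' j).
  by move=> i; have [c [cP _]] := b'P _ (bO i); exists c.
have /choice[N NP] : forall j, exists c : {ffun 'I_n -> K},
    I (b' j - \sum_i tofrac (c i)%:MP * b i).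
  by move=> j; have [c [cP _]] := bP _ (b'O j); exists c.
apply: (@mulmx1_min K _ _ (\matrix_(i, j) M i j) (\matrix_(j, i) N j i)).
apply/matrixP => i k; rewrite !mxE.
under eq_bigr => j _ do rewrite !mxE.
(* The coordinates of [b i] in the basis [b] are unique: they form a unit vector, and also row i of
   the matrix product. *)
have [c [cP cU]] := bP _ (bO i).
have c1 : c = [ffun l => (i == l)%:R].
  apply: cU; rewrite (bigD1 i) //= ffunE eqxx tofrac1 mul1r big1 ?addr0 ?subrr.
    exact: local_ideal0.
  move=> l il; rewrite ffunE eq_sym (negPf il) /=.
  by rewrite (_ : mpolyC 2 _ = 0) ?tofrac0 ?mul0r // mpolyC0.
suff -> : \sum_j M i j * N j k = c k by rewrite c1 ffunE.
rewrite -[RHS]/((fun c : {ffun 'I_n -> K} => c k) c).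
rewrite (cU [ffun k => \sum_j M i j * N j k]) ?ffunE //.
have -> : b i - \sum_l tofrac ([ffun k0 => \sum_j M i j * N j k0] l)%:MP * b l =
    (b i - \sum_j tofrac (M i j)%:MP * b' j) +
    \sum_j tofrac (M i j)%:MP * (b' j - \sum_l tofrac (N j l)%:MP * b l).
  have -> : \sum_j tofrac (M i j)%:MP * (b' j - \sum_l tofrac (N j l)%:MP * b l) =
      \sum_j tofrac (M i j)%:MP * b' j -
      \sum_j \sum_l tofrac (M i j)%:MP * (tofrac (N j l)%:MP * b l).
    by rewrite -sumrB; apply: eq_bigr => j _; rewrite mulrBr mulr_sumr.
  rewrite addrA subrK; congr (_ - _); rewrite exchange_big /=.
  apply: eq_bigr => l _; rewrite ffunE rmorph_sum [tofrac _]rmorph_sum mulr_suml.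
  by apply: eq_bigr => j _; rewrite mulrA -tofracM -mpolyCM.
apply: local_idealD; first exact: MP.
apply: local_ideal_sum => j; apply: local_idealM; last exact: NP.
exact: local_ring_tofrac.
Qed.

End LocalRing.

Lemma local_dim_uniq (K : fieldType) (q : K * K) f g n n' :
  local_dim q f g n -> local_dim q f g n' -> n = n'.
Proof.
by move=> H H'; apply/eqP; rewrite eqn_leq !(@local_dim_le K q f g).
Qed.

Lemma local_ideal_scale (K : fieldType) (q : K * K) f g (c d : K) :
  c != 0 -> d != 0 -> local_ideal q (c *: f) (d *: g) = local_ideal q f g.
Proof.
suff H f' g' (c' d' : K) :
    local_ideal q (c' *: f') (d' *: g') `<=` local_ideal q f' g'.
  move=> c0 d0; apply/seteqP; split; first exact: H.
  have := H (c *: f) (d *: g) c^-1 d^-1.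
  by rewrite !scalerA !mulVf // !scale1r.
move=> _ [s [t [sO tO ->]]]; exists (s * tofrac c'%:MP), (t * tofrac d'%:MP).
split; try by apply: local_ringM => //; exact: local_ring_tofrac.
by rewrite -!mul_mpolyC !tofracM !mulrA.
Qed.

Lemma local_dim_scale (K : fieldType) (q : K * K) f g n (c d : K) :
  c != 0 -> d != 0 -> local_dim q (c *: f) (d *: g) n -> local_dim q f g n.
Proof. by move=> c0 d0; rewrite /local_dim local_ideal_scale. Qed.

(** * Intersection multiplicity with the axis y = 0 at the origin *)

Section RestrictionToAxis.
Variable K : closedFieldType.
Implicit Types (f g h : {mpoly K[2]}) (s : {poly K}).
Local Notation origin := ((0, 0) : K * K).

Definition restrict_axis f : {poly K} := eval_inner 0 (to_poly_poly f).

Lemma restrict_axisD f g :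
  restrict_axis (f + g) = restrict_axis f + restrict_axis g.
Proof. by rewrite /restrict_axis to_poly_polyD; exact: rmorphD. Qed.

Lemma restrict_axisM f g :
  restrict_axis (f * g) = restrict_axis f * restrict_axis g.
Proof. by rewrite /restrict_axis to_poly_polyM eval_innerM. Qed.

Lemma restrict_axisC c : restrict_axis c%:MP = c%:P.
Proof. by rewrite /restrict_axis to_poly_polyC eval_innerC hornerC. Qed.

Lemma restrict_axisX0 : restrict_axis 'X_0 = 'X.
Proof. by rewrite /restrict_axis to_poly_polyX0; exact: map_polyX. Qed.

Lemma restrict_axisX1 : restrict_axis 'X_1 = 0.
Proof. by rewrite /restrict_axis to_poly_polyX1 eval_innerC hornerX. Qed.

Lemma restrict_axisB f g :
  restrict_axis (f - g) = restrict_axis f - restrict_axis g.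
Proof.
rewrite restrict_axisD -mulN1r restrict_axisM -[-1 in LHS](mpolyCN 2 1).
by rewrite restrict_axisC polyCN mulN1r.
Qed.

Lemma restrict_axis_coef f (e : 'X_{1..2}) : e 1 = 0%N ->
  (restrict_axis f)`_(e 0) = f@_e.
Proof.
move=> e1; rewrite -to_poly_poly_coef e1 /restrict_axis coef_map /= /horner_eval.
exact: horner_coef0.
Qed.

Lemma restrict_axis_eval f x : (restrict_axis f).[x] = evalA2 f (x, 0).
Proof. by rewrite horner_eval_inner to_poly_poly_eval. Qed.

Lemma restrict_axis_surj s : exists f, restrict_axis f = s.
Proof.
elim/poly_ind: s => [|s c [f fE]]; first by exists 0%:MP; rewrite restrict_axisC.
exists (f * 'X_0 + c%:MP).
by rewrite restrict_axisD restrict_axisM fE restrict_axisX0 restrict_axisC.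
Qed.

Lemma restrict_axis_eq0 f : restrict_axis f = 0 -> exists g, f = g * 'X_1.
Proof.
move=> /eval_inner_eq0[s]; have [g <-] := to_poly_poly_surj s.
rewrite polyC0 subr0 -to_poly_polyX1 -to_poly_polyM => /to_poly_poly_inj ->.
by exists g.
Qed.

Lemma restrict_axis_comb k (c : 'I_k -> K) :
  restrict_axis (\sum_i (c i)%:MP * 'X_0 ^+ i) = \sum_i (c i)%:P * 'X^i.
Proof.
have XE n : restrict_axis ('X_0 ^+ n) = 'X^n.
  elim: n => [|n IH]; first by rewrite (restrict_axisC 1).
  by rewrite !exprS restrict_axisM IH restrict_axisX0.
elim/big_rec2: _ => [|i s f _ E]; first exact: (restrict_axisC 0).
by rewrite restrict_axisD E restrict_axisM XE restrict_axisC.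
Qed.

Lemma coef_comb k (c : 'I_k -> K) (j : 'I_k) : (\sum_i (c i)%:P * 'X^i)`_j = c j.
Proof.
rewrite coef_sum (bigD1 j) //= coefCM coefXn eqxx mulr1 big1 ?addr0 // => i ij.
rewrite coefCM coefXn; case: eqP => [/val_inj E|_]; last by rewrite mulr0.
by rewrite E eqxx in ij.
Qed.

Lemma size_comb k (c : 'I_k -> K) : (size (\sum_i (c i)%:P * 'X^i)%R <= k)%N.
Proof.
apply: (leq_trans (size_sum _ _ _)); apply/bigmax_leqP => i _.
by rewrite mul_polyC (leq_trans (size_scale_leq _ _)) // size_polyXn.
Qed.

(** Clearing denominators and setting y = 0 removes the second generator. The denominators do not
    vanish at the origin, so on the axis they are prime to x^k. *)
Lemma local_ideal_axis f k (w : {poly K}) (d : {mpoly K[2]}) :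
  restrict_axis f = w * 'X^k -> local_ideal origin f 'X_1 (tofrac d) ->
  'X^k %| restrict_axis d.
Proof.
move=> fE [_ [_ [[s [h [h0 ->]]] [t [h' [h'0 ->]]] dE]]].
have : h * h' * d = s * h' * f + t * h * 'X_1.
  apply/eqP; rewrite -tofrac_eq tofracD !tofracM dE; apply/eqP.
  have arith (A : fieldType) (x y z1 z2 u v : A) : x != 0 -> y != 0 ->
      x * y * (z1 / x * u + z2 / y * v) = z1 * y * u + z2 * x * v.
    by move=> x0 y0; field; rewrite ?x0 ?y0.
  exact: arith (eval_neq0 h0) (eval_neq0 h'0).
move/(congr1 restrict_axis); rewrite restrict_axisD !restrict_axisM restrict_axisX1.
rewrite [X in _ + X]mulr0 addr0 fE mulrA => E.
have : 'X^k %| restrict_axis h * restrict_axis h' * restrict_axis d.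
  by rewrite E dvdp_mulIr.
rewrite Gauss_dvdpr //; apply: coprimep_expl.
rewrite coprimep_sym coprimepX rootE hornerM !restrict_axis_eval.
by rewrite mulf_neq0.
Qed.

(** Modulo y the local ring becomes K[x] localized at 0, where w is a unit; the quotient by x^k has
    the basis 1, x, ..., x^(k-1). *)
Lemma local_dim_axis f k (w : {poly K}) :
  restrict_axis f = w * 'X^k -> w.[0] != 0 -> local_dim origin f 'X_1 k.
Proof.
move=> fE w0; exists (fun i => tofrac ('X_0 ^+ i)); split.
  by move=> i; exact: local_ring_tofrac.
have coprime h : evalA2 h origin != 0 -> coprimep (restrict_axis h) 'X^k.
  by move=> h0; apply: coprimep_expr; rewrite coprimepX rootE restrict_axis_eval.
have combE (c : 'I_k -> K) : \sum_i tofrac (c i)%:MP * tofrac ('X_0 ^+ i) =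
    tofrac (\sum_i (c i)%:MP * 'X_0 ^+ i).
  by rewrite [RHS]rmorph_sum; apply: eq_bigr => i _; rewrite [RHS]tofracM.
move=> x xO; have [g [h [h0 xE]]] := xO.
have /Bezout_eq1_coprimepP[[u v] /= uv] := coprime h h0.
(* By Bezout, u inverts h(x, 0) modulo x^k, so s is the truncation of g/h, and t below is the
   cofactor of x^k in g - h s. *)
set s := (restrict_axis g * u) %% 'X^k.
have sk : (size s <= k)%N.
  have := ltn_modpN0 (restrict_axis g * u) (monic_neq0 (monicXn K k)).
  by rewrite size_polyXn.
have sE : \sum_(i < k) (s`_i)%:P * 'X^i = s.
  rewrite -[RHS](take_poly_id sk) /take_poly poly_def.
  by apply: eq_bigr => i _; rewrite mul_polyC.
pose t := restrict_axis g * v + restrict_axis h * ((restrict_axis g * u) %/ 'X^k).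
have tE : restrict_axis g - restrict_axis h * s = t * 'X^k.
  have -> : s = restrict_axis g * u - (restrict_axis g * u) %/ 'X^k * 'X^k.
    by rewrite [X in _ = X - _](divp_eq _ 'X^k) -/s addrAC subrr add0r.
  rewrite /t -{1}[restrict_axis g]mulr1 -uv; ring.
have [W WE] := restrict_axis_surj w; have [T TE] := restrict_axis_surj t.
have W0 : evalA2 W origin != 0 by rewrite -restrict_axis_eval WE.
pose sigma : {mpoly K[2]} := \sum_(i < k) (s`_i)%:MP * 'X_0 ^+ i.
(* On the axis both terms equal w t x^k, so the difference is a multiple of y. Dividing by W h, a
   unit at the origin, puts x - sigma in the ideal. *)
have [B BE] : exists B, W * (g - h * sigma) - T * f = B * 'X_1.
  apply: restrict_axis_eq0.
  rewrite restrict_axisB !restrict_axisM restrict_axisB restrict_axisM.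
  by rewrite restrict_axis_comb sE tE WE TE fE mulrCA subrr.
have xI : local_ideal origin f 'X_1 (x - tofrac sigma).
  have Wh0 : evalA2 (W * h) origin != 0 by rewrite evalA2M mulf_neq0.
  exists (tofrac T / tofrac (W * h)), (tofrac B / tofrac (W * h)); split.
  - by exists T, (W * h).
  - by exists B, (W * h).
  move: (congr1 (@tofrac _) BE).
  rewrite tofracB !tofracM tofracB tofracM xE.
  have arith (A : fieldType) (w1 y1 y2 y3 z1 z2 u1 u2 : A) : w1 != 0 -> y2 != 0 ->
      w1 * (y1 - y2 * y3) - z1 * u1 = z2 * u2 ->
      y1 / y2 - y3 = z1 / (w1 * y2) * u1 + z2 / (w1 * y2) * u2.
    move=> w10 y20 E; have -> : z1 / (w1 * y2) * u1 + z2 / (w1 * y2) * u2 =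
        (z1 * u1 + z2 * u2) / (w1 * y2) by field; rewrite ?w10 ?y20.
    by rewrite -E; field; rewrite ?w10 ?y20.
  exact: arith (eval_neq0 W0) (eval_neq0 h0).
exists [ffun i : 'I_k => s`_i]; split.
  by rewrite combE; under [X in tofrac X]eq_bigr => i _ do rewrite ffunE.
move=> c'; rewrite combE => c'I; apply/ffunP => i; rewrite ffunE.
(* Two expansions differ by a polynomial in x of degree below k that x^k divides. *)
have := local_idealB xI c'I; rewrite opprB addrC addrA subrK -tofracB.
move=> /(local_ideal_axis fE); rewrite restrict_axisB !restrict_axis_comb sE => kd.
have {kd} : \sum_i (c' i)%:P * 'X^i - s = 0.
  apply/eqP/negPn/negP => /dvdp_leq/(_ kd); rewrite size_polyXn leqNgt ltnS.
  rewrite (leq_trans (size_polyD _ _)) // geq_max size_polyN sk andbT.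
  exact: size_comb.
by move/eqP; rewrite subr_eq0 => /eqP <-; rewrite coef_comb.
Qed.

End RestrictionToAxis.

(** * Local equations at the point p *)

Lemma mcoeff_pihomog (K : fieldType) n d (f : {mpoly K[n]}) e :
  (pihomog mdeg d f)@_e = if mdeg e == d then f@_e else 0.
Proof.
rewrite pihomogE raddf_sum /=.
under eq_bigr => k _ do rewrite mcoeffZ mcoeffX.
have [ef|ef] := boolP (e \in msupp f); last first.
  rewrite big_seq_cond big1 ?(memN_msupp_eq0 ef) ?if_same // => k /andP[kf _].
  case: eqP => [kE|_]; last by rewrite mulr0.
  by rewrite -kE kf in ef.
rewrite big_mkcond (bigD1_seq e) //= ?msupp_uniq // eqxx mulr1 big1 ?addr0 //.
by move=> k ke; rewrite (negPf ke) mulr0 if_same.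
Qed.

Lemma translate_origin (K : fieldType) (f : {mpoly K[2]}) : translate f (0, 0) = f.
Proof.
rewrite /translate -[RHS]comp_mpoly_id; congr (_ \mPo _).
apply: eq_from_tnth => i; rewrite tnth_mktuple (tnth_nth 0) /= mpolyC0 !addr0.
by case: i => [[|[|//]] ilt]; congr 'X_[U_(_)]; apply: val_inj.
Qed.

Lemma multiplicity_at_origin (K : fieldType) (f : {mpoly K[2]}) n :
  multiplicity_at f (0, 0) n <->
  (exists2 e, e \in msupp f & mdeg e = n) /\
  (forall e, e \in msupp f -> (n <= mdeg e)%N).
Proof.
rewrite /multiplicity_at translate_origin; split=> [[fn0 fd]|[[e ef en] fmin]].
  split=> [|e ef].
    have : mlead (pihomog mdeg n f) \in msupp (pihomog mdeg n f).
      exact: mlead_supp.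
    set e := mlead _; rewrite mcoeff_msupp mcoeff_pihomog.
    case: (mdeg e =P n) => [en|_].
      by move=> fe; exists e => //; rewrite mcoeff_msupp; exact: fe.
    by rewrite eqxx.
  rewrite leqNgt; apply/negP => /fd/(congr1 (mcoeff e)).
  by rewrite mcoeff_pihomog eqxx mcoeff0 => /eqP; rewrite mcoeff_eq0 ef.
split.
  apply: contraTneq ef => /(congr1 (mcoeff e)).
  by rewrite mcoeff_pihomog en eqxx mcoeff0 => /eqP; rewrite mcoeff_eq0.
move=> d dn; apply/mpolyP => e'; rewrite mcoeff_pihomog mcoeff0.
case: eqP => // e'd; apply/eqP; rewrite mcoeff_eq0; apply/negP => /fmin.
by rewrite e'd leqNgt dn.
Qed.

Lemma msupp_sum_exists (K : fieldType) n (I : Type) (r : seq I)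
    (f : I -> {mpoly K[n]}) e :
  e \in msupp (\sum_(i <- r) f i) -> exists i, e \in msupp (f i).
Proof.
move=> H; apply: contrapT => N; move: H.
rewrite mcoeff_msupp raddf_sum big1 ?eqxx // => i _; apply/eqP.
by rewrite mcoeff_eq0; apply/negP => ei; apply: N; exists i.
Qed.

Lemma mdeg2 (e : 'X_{1..2}) : mdeg e = (e 0%R + e 1%R)%N.
Proof.
rewrite mdegE big_ord_recl big_ord1; congr (e _ + e _)%N; exact: val_inj.
Qed.

Section AtPoint.
Variables (K : closedFieldType) (m a : nat).
Hypotheses (m_gt0 : (0 < m)%N) (a_gt0 : (0 < a)%N).
Local Notation hirz := (hirzebruch K m).
Local Notation b1 := (false, true).
Local Notation origin := ((0, 0) : K * K).

(** Since x0 and y1 vanish at p, the point lies in one chart only. Local notions at p, stated with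
    an unspecified chart, are therefore computed at the origin of this one. *)
Lemma chart_pt_p b (q : K * K) : chart m b q = pt_p <-> b = b1 /\ q = origin.
Proof.
rewrite /chart /pt_p pi_hirzebruchP; split=> [[l [u [l0 u0]]]|[-> ->]]; last first.
  exists 1, 1; rewrite !oner_neq0 /affine_coord /= expr1n invr1 !mul1r.
  by split.
case: b q => [bx by_] [x y]; rewrite /affine_coord.
case: bx by_ => [] [] /= [].
- by move=> /eqP; rewrite mulr1 eq_sym (negPf u0).
- by move=> /eqP; rewrite mulr1 eq_sym (negPf u0).
- move=> /esym/eqP; rewrite mulf_eq0 (negPf u0) /= => /eqP -> _ _ /esym/eqP.
  by rewrite mulf_eq0 (negPf l0) /= => /eqP ->.
- by move=> _ _ _ /eqP; rewrite mulr1 eq_sym (negPf l0).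
Qed.

Section Local.
Variables (F : {mpoly K[2]}) (C : divisor K m).
Hypotheses (Fd : bidegree a (a * m) F) (FC : polynomial_divisor a F C).
Let f : {mpoly K[2]} := dehomogenize b1 (hirzebruch_form m a F).

Lemma local_equation_at_pt : local_equation C b1 f.
Proof. by have [_] := divisor_of_zeros_form m_gt0 a_gt0 Fd FC. Qed.

Lemma msupp_at_pt (e : 'X_{1..2}) : e \in msupp f <->
  exists2 k : 'X_{1..2}, k \in msupp F &
    e 0%R = k 0%R /\ e 1%R = (m * (a - k 0%R) - k 1%R)%N.
Proof.
have Ffits := bidegree_fits m_gt0 a_gt0 Fd.
rewrite /f /hirzebruch_form dehomogenize_homogenize; split=> [|[k kF [e0 e1]]].
  move=> /msupp_sum_le/flatten_mapP[k]; rewrite mem_filter /= => kF.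
  by move=> /msuppZ_le; rewrite msuppX inE => /eqP ->; exists k.
have -> : e = [multinom [tuple homogenize_monomial m affine_chart a 0 k 0;
             homogenize_monomial m affine_chart a 0 k 3]].
  by apply/eqP; rewrite eq_mnm2 !mnm2E !homogenize_monomialE e0 e1 !eqxx.
rewrite mcoeff_msupp (mcoeff_sum_monomials kF) -?mcoeff_msupp // => k1 k2.
move=> /Ffits[A1 A1'] /Ffits[A2 A2'] /eqP; rewrite eq_mnm2 !mnm2E.
rewrite !homogenize_monomialE /= => /andP[/eqP E0 /eqP E1]; apply/eqP.
by rewrite eq_mnm2 E0 eqxx /=; move: A1' A2' E1; rewrite /= E0; lia.
Qed.

Lemma msupp_at_pt_bound (e : 'X_{1..2}) : e \in msupp f ->
  (e 0%R <= a)%N /\ (e 1%R <= m * (a - e 0%R))%N.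
Proof.
move=> /msupp_at_pt[k kF [-> ->]].
by have [] := bidegree_fits m_gt0 a_gt0 Fd kF; split=> //; rewrite leq_subr.
Qed.

Lemma bidegree_at_pt r : (r < a)%N ->
  bidegree a (a * m - r) F <->
  forall e : 'X_{1..2}, e \in msupp f -> ((a - e 0%R) * r <= a * e 1%R)%N.
Proof.
move=> ra; have am : (r < a * m)%N by rewrite (leq_trans ra) // leq_pmulr.
have b0 : (0 < a * m - r)%N by rewrite subn_gt0.
have arith (i c j d r' s m' : nat) :
    (m' * c = j + d)%N -> ((i + c) * m' = r' + s)%N ->
    (i * s + j * (i + c) <= (i + c) * s)%N = (c * r' <= (i + c) * d)%N.
  move=> jd rs; have : (c * (r' + s) = (i + c) * (j + d))%N by rewrite -rs -jd; lia.
  by rewrite !mulnDr !mulnDl; lia.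
have aux (k : 'X_{1..2}) : k \in msupp F ->
    (k 0%R * (a * m - r) + k 1%R * a <= a * (a * m - r))%N =
    ((a - k 0%R) * r <= a * (m * (a - k 0%R) - k 1%R))%N.
  move=> /(bidegree_fits m_gt0 a_gt0 Fd)[ka kb]; rewrite add0n /= in kb.
  have := arith (k 0%R) (a - k 0%R)%N (k 1%R) (m * (a - k 0%R) - k 1%R)%N
    r (a * m - r)%N m.
  by rewrite !subnKC //; [apply|exact: ltnW].
split=> H => [e /msupp_at_pt[k kF [-> ->]]|k kF].
  by rewrite -aux // -in_triangleP //; exact: H.
rewrite in_triangleP // aux //.
have := H [multinom [tuple k 0%R; (m * (a - k 0%R) - k 1%R)%N]].
by rewrite !mnm2E; apply; apply/msupp_at_pt; exists k; rewrite ?mnm2E.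
Qed.

Lemma component_at_pt : component fiber_y1 C <->
  forall e : 'X_{1..2}, e \in msupp f -> (0 < e 1%R)%N.
Proof.
have Xirr := @irreducibleXU K 1.
have Xp := prime_divisor_curve m b1 Xirr.
have := local_equation_at_pt Xp (meets_chart_curve m b1 Xirr).
rewrite /component fiber_y1E => Cf; split=> [C0|H].
  move: Cf => /(ord_along_curve _ _ _ _ Xirr)[[|k] [Ck kf _]].
    by rewrite Ck eqxx in C0.
  by move/mdivides_XnP: kf => kf e /kf; apply: leq_trans.
have /mdivides_XnP X1f : forall e : 'X_{1..2}, e \in msupp f -> (1 <= e 1%R)%N.
  by [].
by rewrite expr1 in X1f; have := ord_along_pos Xirr X1f Cf; case: eqP => // ->.
Qed.

Lemma multiplicity_at_pt n : multiplicity C pt_p n <-> multiplicity_at f origin n.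
Proof.
split=> [[b [q [f' [/chart_pt_p[-> ->] Cf' f'n]]]]|fn]; last first.
  exists b1, origin, f; split=> //; last exact: local_equation_at_pt.
  exact/chart_pt_p.
have [c c0 fE] := local_equation_uniq Cf' local_equation_at_pt.
move: f'n; rewrite fE !multiplicity_at_origin => -[[e ef' en] f'min].
have suppE := perm_mem (msuppZ f' c0); split; first by exists e; rewrite ?suppE.
by move=> e'; rewrite suppE; exact: f'min.
Qed.

Lemma intersection_at_pt n :
  intersection_multiplicity C (mult_prime 1 fiber_y1) pt_p n <->
  local_dim origin f 'X_1 n.
Proof.
have fib := @local_equation_fiber K m b1.
have [_ _ _ E3] := dehomogenizeXU K b1; rewrite E3 in fib.
split=> [[b [q [f' [g' [/chart_pt_p[-> ->] Cf' Fg' f'g'n]]]]]|fn]; last first.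
  exists b1, origin, f, 'X_1; split=> //; last exact: local_equation_at_pt.
  exact/chart_pt_p.
have [c c0 f'E] := local_equation_uniq local_equation_at_pt Cf'.
have [d d0 g'E] := local_equation_uniq fib Fg'.
by move: f'g'n; rewrite f'E g'E; exact: local_dim_scale.
Qed.

(** For r = 1 the inequality a - i <= a l is automatic when l > 0 and forces i = a when l = 0. So it
    says that f(x, 0), of degree at most a, is zero or a multiple of x^a. *)
Lemma bidegree_intersection : (1 < a)%N ->
  bidegree a (a * m - 1) F <->
  intersection_multiplicity C (mult_prime 1 fiber_y1) pt_p a \/
  component fiber_y1 C.
Proof.
move=> a1; rewrite bidegree_at_pt // intersection_at_pt component_at_pt.
have [f0|rf0] := eqVneq (restrict_axis f) 0.
  have X1f : forall e : 'X_{1..2}, e \in msupp f -> (0 < e 1%R)%N.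
    move=> e ef; rewrite lt0n; apply: contraTneq ef => e1.
    by rewrite -mcoeff_eq0 -restrict_axis_coef // f0 coef0.
  split=> [_|_ e /X1f]; first by right.
  by rewrite muln1 => e1; apply: (leq_trans (leq_subr _ _)); rewrite leq_pmulr.
have nX1 : ~ forall e : 'X_{1..2}, e \in msupp f -> (0 < e 1%R)%N.
  move=> H; case/negP: rf0; apply/eqP/polyP => i; rewrite coef0.
  have := restrict_axis_coef f (e := [multinom [tuple i; 0%N]]).
  rewrite !mnm2E => /(_ erefl) ->; apply/eqP; rewrite mcoeff_eq0; apply/negP => /H.
  by rewrite mnm2E.
have [k [w [w0 fE]]] : exists k w, w.[0] != 0 /\ restrict_axis f = w * 'X^k.
  have [k [w [w0 fE]]] := multiplicity_XsubC (restrict_axis f) 0.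
  move: w0; rewrite rf0 /= rootE => w0.
  by exists k, w; rewrite fE polyC0 subr0.
have fk := local_dim_axis fE w0.
have fcoef i : (restrict_axis f)`_i = if (i < k)%N then 0 else w`_(i - k).
  by rewrite fE coefMXn.
pose ek : 'X_{1..2} := [multinom [tuple k; 0%N]].
have fcoefE i : f@_[multinom [tuple i; 0%N]] = (restrict_axis f)`_i.
  by rewrite -restrict_axis_coef !mnm2E.
have ekf : ek \in msupp f.
  by rewrite mcoeff_msupp fcoefE fcoef ltnn subnn -horner_coef0.
have [ka _] := msupp_at_pt_bound ekf; rewrite mnm2E in ka.
split=> [H|[fa|//]].
  left; suff -> : a = k by [].
  have := H ek ekf; rewrite !mnm2E muln0 muln1 leqn0 subn_eq0 => ak.
  by apply/eqP; rewrite eqn_leq ak ka.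
have ak := local_dim_uniq fa fk; move=> e ef.
rewrite muln1; case: (posnP (e 1%R)) => [e1|e1]; last first.
  by apply: (leq_trans (leq_subr _ _)); rewrite leq_pmulr.
rewrite e1 muln0 leqn0 subn_eq0 ak leqNgt; apply/negP => lt.
move: ef; rewrite mcoeff_msupp -restrict_axis_coef // fcoef lt.
by rewrite eqxx.
Qed.

(** As each [g i] is homogeneous, the exponent of y1 determines the monomial, so setting y0 = 1
    causes no cancellation. *)
Lemma msupp_form_of (g : 'I_a.+1 -> {mpoly K[2]}) (e : 'X_{1..2}) :
  (forall i : 'I_a.+1, g i \is (m * (a - i)).-homog) ->
  e \in msupp (dehomogenize b1 (form_of g)) <->
  exists (i : 'I_a.+1) (e' : 'X_{1..2}),
    [/\ e' \in msupp (g i), e 0%R = i & e 1%R = e' 1%R].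
Proof.
move=> ghom; have -> : dehomogenize b1 (form_of g) = \sum_(i < a.+1)
    \sum_(e' <- msupp (g i)) (g i)@_e' *: 'X_[[multinom [tuple (i : nat); e' 1%R]]].
  rewrite [LHS]dehomogenize_sum; apply: eq_bigr => i _.
  rewrite [LHS]dehomogenizeM dehomogenizeM !dehomogenizeX.
  have [-> -> E2 E3] := dehomogenizeXU K b1.
  rewrite expr1n mulr1 comp_mpolyEX dehomogenize_sum mulr_sumr.
  apply: eq_bigr => e' _; rewrite dehomogenizeZ -scalerAr.
  congr (_ *: _); rewrite comp_mpolyX prod_ord2 !(tnth_nth 0) /=.
  rewrite dehomogenizeM !dehomogenizeX E2 E3.
  by rewrite expr1n mul1r [RHS]mpolyXE_id prod_ord2 !mnm2E.
split=> [|[i [e' [e'g e0 e1]]]].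
  move=> ee; have [i ei] := msupp_sum_exists ee.
  have [e' ee'] := msupp_sum_exists ei; exists i, e'.
  have e'g : e' \in msupp (g i).
    move: ee'; rewrite !mcoeff_msupp mcoeffZ; apply: contraNneq => ->.
    by rewrite mul0r.
  by move: ee' => /msuppZ_le; rewrite msuppX inE => /eqP ->; rewrite !mnm2E.
rewrite mcoeff_msupp raddf_sum (bigD1 i) //= raddf_sum.
rewrite (bigD1_seq e') ?msupp_uniq //=.
have eE (l : nat) (e'' : 'X_{1..2}) : ([multinom [tuple l; e'' 1%R]] == e) =
    (l == i) && (e'' 1%R == e' 1%R).
  by rewrite eq_mnm2 !mnm2E e0 e1.
rewrite mcoeffZ mcoeffX eE !eqxx mulr1 [X in _ + X + _]big_seq_cond.
rewrite [X in _ + X + _]big1 => [|e'' /andP[e''g ne]]; last first.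
  rewrite mcoeffZ mcoeffX eE eqxx /=; case: eqP => [E1|]; last by rewrite mulr0.
  have D : {in msupp (g i), forall k, mdeg k = (m * (a - i))%N} by exact: dhomog_mf.
  have := D _ e''g; have := D _ e'g.
  rewrite !mdeg2 E1 => <- /addIn E0; case/negP: ne.
  by rewrite eq_mnm2 E0 E1 !eqxx.
rewrite addr0 big1 ?addr0 -?mcoeff_msupp // => l li.
rewrite raddf_sum big1 //= => e'' _; rewrite mcoeffZ mcoeffX eE.
by rewrite val_eqE (negPf li) mulr0.
Qed.

Lemma bidegree_form_of (g : 'I_a.+1 -> {mpoly K[2]}) r :
  (forall i : 'I_a.+1, g i \is (m * (a - i)).-homog) ->
  divisor_of_zeros (form_of g) C -> (r < a)%N ->
  bidegree a (a * m - r) F <->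
  forall i : 'I_a.+1, mdivides ('X_1 ^+ (r - (i * r) %/ a)) (g i).
Proof.
move=> ghom Cg ra; rewrite bidegree_at_pt //.
(* The given form and the form of F have the same divisor, so their equations at p share their
   monomials. *)
have [c c0 gE] := local_equation_uniq local_equation_at_pt (Cg b1).
have suppE := msupp_form_of _ ghom; rewrite gE in suppE.
(* The bound r - y <= floor(ir/a) amounts to (r - y) a <= ir. *)
have arith (i y : nat) : (i <= a)%N ->
    (r - (i * r) %/ a <= y)%N = ((a - i) * r <= a * y)%N.
  move=> ia; rewrite leq_subLR addnC -leq_subLR leq_divRL // !mulnBl !leq_subLR.
  by rewrite [in LHS]mulnC [in RHS]addnC [(a * y)%N]mulnC addnC.
split=> [H i|H e ef].
  apply/mdivides_XnP => e eg; rewrite arith ?leq_ord //.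
  have := H [multinom [tuple (i : nat); e 1%R]]; rewrite !mnm2E; apply.
  rewrite -(perm_mem (msuppZ f c0)); apply/suppE; exists i, e.
  by rewrite !mnm2E.
have /suppE[i [e' [e'g -> ->]]] : e \in msupp (c *: f).
  by rewrite (perm_mem (msuppZ f c0)).
rewrite -arith ?leq_ord //; exact: (mdivides_XnP _ _ _).1 (H i) _ e'g.
Qed.

Lemma tangent_directionP (D : divisor K m) (g : {mpoly K[2]}) n (w : K * K) :
  local_equation D b1 g -> multiplicity_at g origin n ->
  tangent_direction D b1 origin w <-> w != 0 /\ evalA2 (pihomog mdeg n g) w = 0.
Proof.
move=> Dg gn; split=> [[g' [n' [Dg' g'n' w0 gw]]]|[w0 gw]]; last first.
  by exists g, n; rewrite translate_origin.
split=> //; have [c c0 g'E] := local_equation_uniq Dg Dg'.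
move: g'n' gw; rewrite translate_origin g'E linearZ /= => g'n'.
have -> : n' = n.
  move: gn g'n'; rewrite !multiplicity_at_origin.
  move=> [[e eg <-] gmin] [[e' e'g <-] g'min].
  have suppE := perm_mem (msuppZ g c0).
  by apply/eqP; rewrite eqn_leq gmin -?suppE // g'min ?suppE.
rewrite /evalA2 mevalZ => /eqP; rewrite mulf_eq0 (negPf c0) => /eqP ->.
by [].
Qed.

Lemma tangent_direction_fiber (w : K * K) :
  tangent_direction (mult_prime 1 (fiber_y1 : set hirz)) b1 origin w <->
  w != 0 /\ w.2 = 0.
Proof.
have fib := @local_equation_fiber K m b1.
have [_ _ _ E3] := dehomogenizeXU K b1; rewrite E3 in fib.
rewrite (tangent_directionP (n := 1) w fib).
  by rewrite pihomogX /= mdeg1 /= evalA2XU.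
apply/multiplicity_at_origin; split=> [|e].
  by exists U_(1)%MM; rewrite ?mdeg1 // msuppX inE.
by rewrite msuppX inE => /eqP ->; rewrite mdeg1.
Qed.

Lemma eval_pihomog2 (g : {mpoly K[2]}) (w : K * K) :
  evalA2 (pihomog mdeg 2 g) w =
  g@_[multinom [tuple 2%N; 0%N]] * w.1 ^+ 2 +
  g@_[multinom [tuple 1%N; 1%N]] * (w.1 * w.2) +
  g@_[multinom [tuple 0%N; 2%N]] * w.2 ^+ 2.
Proof.
have -> : pihomog mdeg 2 g =
    g@_[multinom [tuple 2%N; 0%N]] *: 'X_[[multinom [tuple 2%N; 0%N]]] +
    g@_[multinom [tuple 1%N; 1%N]] *: 'X_[[multinom [tuple 1%N; 1%N]]] +
    g@_[multinom [tuple 0%N; 2%N]] *: 'X_[[multinom [tuple 0%N; 2%N]]].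
  apply/mpolyP => e; rewrite mcoeff_pihomog !mcoeffD !mcoeffZ !mcoeffX.
  have -> : e = [multinom [tuple e 0%R; e 1%R]].
    by apply/eqP; rewrite eq_mnm2 !mnm2E !eqxx.
  rewrite mdeg2 !eq_mnm2 !mnm2E.
  by case: (e 0%R) (e 1%R) => [|[|[|i]]] [|[|[|j]]];
    rewrite ?addnS ?eqSS ?mulr0 ?mulr1 ?addr0 ?add0r.
rewrite /evalA2 !mevalD !mevalZ !mevalX !prod_ord2 !mnm2E /=.
by rewrite !expr0 !expr1 !mulr1 !mul1r.
Qed.

Lemma exists_multiplicity_at_pt : exists n, multiplicity_at f origin n.
Proof.
have f0 := local_equation_neq0 local_equation_at_pt.
have [|n /mapP[e ef en] nmin] := @ex_minnP (mem (map mdeg (msupp f))).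
  by exists (mdeg (mlead f)); apply/map_f/mlead_supp.
exists n; apply/multiplicity_at_origin; split; first by exists e.
by move=> e' e'f; apply/nmin/map_f.
Qed.

(** * The case r = 2 and a = 3 *)

Hypothesis a3 : a = 3%N.

(** The inequality forbids exactly the monomials 1, x, x^2, y and xy, so the quadratic part of f is
    a multiple of y^2. *)
Lemma bidegree_at_pt2 : bidegree a (a * m - 2) F <->
  forall e : 'X_{1..2}, e \in msupp f -> ((3 - e 0%R) * 2 <= 3 * e 1%R)%N.
Proof. by rewrite bidegree_at_pt a3. Qed.

Lemma double_tangent_along_fiber :
  multiplicity_at f origin 2 ->
  (forall e : 'X_{1..2}, e \in msupp f -> mdeg e = 2%N -> (e 0%R = 0)%N) <->
  same_tangent_directions C (mult_prime 1 fiber_y1) pt_p.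
Proof.
move=> f2; have tanC w := tangent_directionP w local_equation_at_pt f2.
have tanE := tangent_direction_fiber.
split=> [H b q /chart_pt_p[-> ->] w|H].
  rewrite tanC tanE eval_pihomog2.
  have z i j : (i + j.+1 = 2)%N -> f@_[multinom [tuple j.+1; i]] = 0.
    move=> ij; apply/eqP; rewrite mcoeff_eq0; apply/negP => /H.
    by rewrite mdeg2 !mnm2E addnC ij => /(_ erefl).
  rewrite !z // !mul0r !add0r.
  have c0 : f@_[multinom [tuple 0%N; 2%N]] != 0.
    have /multiplicity_at_origin[[e ef e2] _] := f2.
    have := H e ef e2; rewrite -mcoeff_msupp => e0.
    suff -> : [multinom [tuple 0%N; 2%N]] = e by [].
    by apply/eqP; rewrite eq_mnm2 !mnm2E; move: e2; rewrite mdeg2 e0 add0n => ->.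
  split=> [[w0 /eqP]|[w0 ->]]; last by rewrite expr2 mulr0 mulr0.
  by rewrite mulf_eq0 (negPf c0) expf_eq0 /= => /eqP.
have tan w : w != 0 -> evalA2 (pihomog mdeg 2 f) w = 0 <-> w.2 = 0.
  move=> w0; have := H b1 origin (proj2 (chart_pt_p _ _) (conj erefl erefl)) w.
  rewrite tanC tanE => -[H1 H2]; split=> [E|E]; first by have [] := H1 (conj w0 E).
  by have [] := H2 (conj w0 E).
have z2 : f@_[multinom [tuple 2%N; 0%N]] = 0.
  have := (tan (1, 0) _).2 erefl; rewrite eval_pihomog2 /=.
  rewrite expr1n mulr1 !mulr0 expr2 mulr0 mulr0 !addr0; apply.
  by rewrite xpair_eqE oner_eq0.
have z1 : f@_[multinom [tuple 1%N; 1%N]] = 0.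
  apply/eqP/negPn/negP => c0; set c := f@_[multinom [tuple 1%N; 1%N]] in c0 *.
  set d := f@_[multinom [tuple 0%N; 2%N]].
  (* With no x^2 term the quadratic part is y (c x + d y); if c were nonzero, (d, -c) would be a
     second tangent direction. *)
  have w0 : (d, - c) != 0 by rewrite xpair_eqE negb_and oppr_eq0 c0 orbT.
  have /(tan _ w0)/eqP : evalA2 (pihomog mdeg 2 f) (d, - c) = 0.
    by rewrite eval_pihomog2 z2 -/c -/d /=; ring.
  by rewrite oppr_eq0 (negPf c0).
move=> e ef e2; have eE : e = [multinom [tuple e 0%R; e 1%R]].
  by apply/eqP; rewrite eq_mnm2 !mnm2E !eqxx.
move: ef e2; rewrite mcoeff_msupp mdeg2 {1}eE => fe e2; apply/eqP; move: fe.
apply: contraTT => e0; have [e0E|e0E] : e 0%R = 1%N \/ e 0%R = 2%N by lia.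
  by rewrite e0E (_ : e 1%R = 1%N) ?z1 ?eqxx //; lia.
by rewrite e0E (_ : e 1%R = 0%N) ?z2 ?eqxx //; lia.
Qed.

Lemma bidegree_of_multiplicity :
  (exists2 n, (3 <= n)%N & multiplicity C pt_p n) \/
  (multiplicity C pt_p 2 /\
   same_tangent_directions C (mult_prime 1 fiber_y1) pt_p) ->
  bidegree a (a * m - 2) F.
Proof.
rewrite bidegree_at_pt2.
move=> [[n n3 /multiplicity_at_pt/multiplicity_at_origin[_ H]]|].
  by move=> e /H; rewrite mdeg2; lia.
move=> [/multiplicity_at_pt f2 /(double_tangent_along_fiber f2) T].
have /multiplicity_at_origin[_ H] := f2.
(* A quadratic monomial is y^2, where the inequality is an equality; from degree three on, l >= 3 -
   i gives it. *)
move=> e ef; have := T e ef; have := H e ef; rewrite mdeg2; lia.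
Qed.

Lemma multiplicity_of_bidegree : bidegree a (a * m - 2) F ->
  (exists2 n, (3 <= n)%N & multiplicity_at f origin n) \/
  (multiplicity C pt_p 2 /\
   same_tangent_directions C (mult_prime 1 fiber_y1) pt_p).
Proof.
rewrite bidegree_at_pt2 => H; have [n fn] := exists_multiplicity_at_pt.
have /multiplicity_at_origin[[e ef en] nmin] := fn.
have n2 : (2 <= n)%N by have := H e ef; rewrite -en mdeg2; lia.
have [n3|n3] := leqP 3 n; [by left; exists n|right].
have nE : n = 2%N by lia.
rewrite nE in fn; split; first exact/multiplicity_at_pt.
apply/(double_tangent_along_fiber fn) => e' e'f.
by have := H e' e'f; rewrite mdeg2; lia.
Qed.

Lemma bidegree_multiplicity : bidegree a (a * m - 2) F <->
  (exists2 n, (3 <= n)%N & multiplicity C pt_p n) \/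
  (multiplicity C pt_p 2 /\
   same_tangent_directions C (mult_prime 1 fiber_y1) pt_p).
Proof.
split; last exact: bidegree_of_multiplicity.
move/multiplicity_of_bidegree => [[n n3 fn]|]; [left|by right].
by exists n => //; apply/multiplicity_at_pt.
Qed.

(** What has to be excluded is multiplicity above three. For m = 1 the exponents satisfy i + l <= 3;
    if the fiber is not a component, f contains a pure power of x. *)
Lemma bidegree_triple_point : m = 1%N \/ ~ component fiber_y1 C ->
  bidegree a (a * m - 2) F <->
  multiplicity C pt_p 3 \/
  (multiplicity C pt_p 2 /\
   same_tangent_directions C (mult_prime 1 fiber_y1) pt_p).
Proof.
move=> mC; split=> [Fb|[f3|f2]]; last by apply: bidegree_of_multiplicity; right.
  case: (multiplicity_of_bidegree Fb) => [[n n3 fn]|]; [left|by right].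
  apply/multiplicity_at_pt; suff <- : n = 3%N by [].
  have /multiplicity_at_origin[[e ef en] nmin] := fn.
  case: mC => [m1|nfib].
    have [] := msupp_at_pt_bound ef; rewrite m1 a3 mul1n => e0 e1.
    by move: n3 en; rewrite mdeg2; lia.
  (* For this monomial x^i the inequality with l = 0 gives i >= 3, while i <= a = 3, so the
     multiplicity is at most three. *)
  have [e' e'f e'1] : exists2 e' : 'X_{1..2}, e' \in msupp f & (e' 1%R = 0)%N.
    apply: contrapT => N; apply: nfib; apply/component_at_pt => e' e'f.
    by rewrite lt0n; apply/eqP => e'1; apply: N; exists e'.
  move/bidegree_at_pt2: Fb => /(_ _ e'f); have [] := msupp_at_pt_bound e'f.
  have := nmin _ e'f; rewrite mdeg2 a3; lia.
by apply: bidegree_of_multiplicity; left; exists 3.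
Qed.

End Local.
End AtPoint.

Local Close Scope classical_set_scope.

(** Criterion (B) is given in two forms because the multiplicity at p can exceed three: for a = 3, m
    >= 2 and F = 1 the local equation at p is y^(3m). The condition [1 < a] in (A) is r < a for r =
    1. *)
Theorem lemma3p3 (R : realType) (a m : nat) (a_ge1 : (1 <= a)%N)
    (m_ge1 : (1 <= m)%N) :
  (* (1) *)
  (forall F : {mpoly R[i][2]}, F != 0 -> bidegree a (a * m) F ->
     exists! C : divisor R[i] m, polynomial_divisor a F C) /\
  (* (2) *)
  (forall C : divisor R[i] m,
     effective C -> linear_equiv C (mult_prime a%:Z Splus) ->
     exists F : {mpoly R[i][2]},
       [/\ bidegree a (a * m) F, polynomial_divisor a F C,
           forall F' : {mpoly R[i][2]}, bidegree a (a * m) F' ->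
             polynomial_divisor a F' C -> exists2 c : R[i], c != 0 & F' = c *: F
         & irreducible_divisor C -> irreducible_mpoly F]) /\
  (* equivalence of (i) and (ii), then (A) and (B) *)
  (forall (F : {mpoly R[i][2]}) (C : divisor R[i] m),
     bidegree a (a * m) F -> polynomial_divisor a F C ->
     [/\ forall g : 'I_a.+1 -> {mpoly R[i][2]},
           (forall i : 'I_a.+1, g i \is (m * (a - i)).-homog) ->
           divisor_of_zeros (form_of g) C ->
           forall r : nat, (r < a)%N ->
             (bidegree a (a * m - r) F <->
              forall i : 'I_a.+1, mdivides ('X_1 ^+ (r - (i * r) %/ a)) (g i)),
         (1 < a)%N ->
           (bidegree a (a * m - 1) F <->
            intersection_multiplicity C (mult_prime 1 fiber_y1) pt_p a \/
            component fiber_y1 C),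
         a = 3%N ->
           (bidegree a (a * m - 2) F <->
            (exists2 n : nat, (3 <= n)%N & multiplicity C pt_p n) \/
            (multiplicity C pt_p 2 /\
             same_tangent_directions C (mult_prime 1 fiber_y1) pt_p))
       & a = 3%N -> m = 1%N \/ ~ component fiber_y1 C ->
           (bidegree a (a * m - 2) F <->
            multiplicity C pt_p 3 \/
            (multiplicity C pt_p 2 /\
             same_tangent_directions C (mult_prime 1 fiber_y1) pt_p))]).
Proof.
split; first exact: exists_unique_polynomial_divisor.
split=> [C Ce Cl|F C Fd FC].
  have [F [F0 Fd CF]] := exists_form m_ge1 a_ge1 Ce Cl.
  have CF0 := CF affine_chart; rewrite homogenizeK in CF0.
  have FC : polynomial_divisor a F C by [].
  exists F; split=> //; last exact: irreducible_of_irreducible_divisor Fd FC.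
  by move=> F' _ [_ _]; exact: local_equation_uniq CF0.
split.
- move=> g ghom Cg r; exact: (bidegree_form_of m_ge1 a_ge1 Fd FC ghom Cg).
- exact: (bidegree_intersection m_ge1 a_ge1 Fd FC).
- by move=> a3; exact: (bidegree_multiplicity m_ge1 a_ge1 Fd FC a3).
- by move=> a3; exact: (bidegree_triple_point m_ge1 a_ge1 Fd FC a3).
Qed.
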